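(* Let $I$ be any Scott ideal in the Turing degrees and $\mathrm{Aut}_I(\overline{\mathbb{Q}})=\{f\in\mathrm{Aut}(\overline{\mathbb{Q}}):\deg(f)\in I\}$. Then for every $\Sigma_2$-separated sentence $\psi(\vec{a})$ in the language of groups with parameters $\vec{a}$ from $\mathrm{Aut}_I(\overline{\mathbb{Q}})$, and also for every negation of such a sentence, the sentence holds in $\mathrm{Aut}_I(\overline{\mathbb{Q}})$ if and only if it holds in $\mathrm{Aut}(\overline{\mathbb{Q}})$.
   Context: $\overline{\mathbb{Q}}$ is a fixed computable presentation (domain $\omega$) of the algebraic closure of $\mathbb{Q}$. Let $F_0=\mathbb{Q}\subset F_1\subset\cdots$ be the computable sequence of number fields, each normal over $\mathbb{Q}$, with $\bigcup_nF_n=\overline{\mathbb{Q}}$, where $F_n=\mathbb{Q}(z_n)$ for effectively found primitive generators $z_n$. Each $f\in\mathrm{Aut}(\overline{\mathbb{Q}})$ is identified with $(f(z_1),f(z_2),\ldots)\in\omega^\omega$, and $\deg(f)$ is the Turing degree of this sequence. A Scott ideal is a proper nonempty set $I$ of Turing degrees, closed under joins and downward under $\le_T$, such that every $\boldsymbol{c}\in I$ has some $\boldsymbol{d}\in I$ that is PA relative to $\boldsymbol{c}$ (i.e. $\boldsymbol{d}$ computes a path through every infinite $\boldsymbol{c}$-computable finitely-branching tree with $\boldsymbol{c}$-computable branching). A formula in prenex form is positive if it does not use $\neg$. A formula is quantifier-free negative if it is built from negated atomic formulas using $\wedge$ and $\vee$. A formula is separated (equivalently $\Sigma_0$-separated and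 $\Pi_0$-separated) if it is either positive, or the conjunction of a positive formula (which may contain quantifiers) and a quantifier-free negative formula. A formula is $\Sigma_{n+1}$-separated if it has the form $\exists\vec{G}\,\beta(\vec{G})$ with $\beta$ $\Pi_n$-separated, and $\Pi_{n+1}$-separated if it has the form $\forall\vec{G}\,\beta(\vec{G})$ with $\beta$ $\Sigma_n$-separated. *)

(* Defs.v *)
From HB Require Import structures.
From mathcomp Require Import all_boot all_order all_algebra all_field.
From mathcomp Require Import boolp classical_sets functions cardinality.

Set Implicit Arguments.
Unset Strict Implicit.
Unset Printing Implicit Defensive.

Import GRing.Theory.

Local Open Scope classical_set_scope.

(* Kleene's mu-recursive schemes with an oracle, acting on argument lists.    *)
(* [Prec f h] recurses on the first argument, with the step [h] applied to    *)
(* the counter, the previous value and the remaining arguments.               *)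
Inductive prog : Type :=
| Zero
| Succ
| Proj of nat
| Oracle
| Comp of prog & seq prog
| Prec of prog & prog
| Mu of prog.

Inductive eval (O : nat -> nat) : prog -> seq nat -> nat -> Prop :=
| eval_Zero xs : eval O Zero xs 0
| eval_Succ x xs : eval O Succ (x :: xs) x.+1
| eval_Proj i xs : i < size xs -> eval O (Proj i) xs (nth 0 xs i)
| eval_Oracle x xs : eval O Oracle (x :: xs) (O x)
| eval_Comp f hs xs ys y :
    evals O hs xs ys -> eval O f ys y -> eval O (Comp f hs) xs y
| eval_Prec0 f h xs y : eval O f xs y -> eval O (Prec f h) (0 :: xs) y
| eval_PrecS f h n xs r y :
    eval O (Prec f h) (n :: xs) r -> eval O h (n :: r :: xs) y ->
    eval O (Prec f h) (n.+1 :: xs) y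
| eval_Mu f xs n (k : nat -> nat) :
    eval O f (n :: xs) 0 ->
    (forall m, m < n -> eval O f (m :: xs) (k m).+1) ->
    eval O (Mu f) xs n
with evals (O : nat -> nat) : seq prog -> seq nat -> seq nat -> Prop :=
| evals_nil xs : evals O [::] xs [::]
| evals_cons h hs xs y ys :
    eval O h xs y -> evals O hs xs ys -> evals O (h :: hs) xs (y :: ys).

Definition turing_le (f g : nat -> nat) : Prop :=
  exists e : prog, forall x, eval g e [:: x] (f x).

Definition computable (f : nat -> nat) : Prop :=
  exists e : prog, forall x, eval (fun=> 0) e [:: x] (f x).

Definition computable2 (f : nat -> nat -> nat) : Prop :=
  exists e : prog, forall x y, eval (fun=> 0) e [:: x; y] (f x y).

Definition turing_equiv (f g : nat -> nat) : Prop :=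
  turing_le f g /\ turing_le g f.

(* Turing degrees are the classes of [turing_equiv]. *)
Record tdegree := TDegree {
  tdegree_set :> set (nat -> nat);
  tdegreeP : exists f, tdegree_set = [set g | turing_equiv g f] }.

Definition deg (f : nat -> nat) : tdegree :=
  @TDegree [set g | turing_equiv g f] (ex_intro _ f erefl).

Definition tjoin (f g : nat -> nat) : nat -> nat :=
  fun n => if odd n then g n./2 else f n./2.

Definition is_tree (T : pred (seq nat)) : Prop :=
  forall s t, T (s ++ t) -> T s.

(* [b] gives the (finite) number of immediate successors of each node. *)
Definition branching (T : pred (seq nat)) (b : seq nat -> nat) : Prop :=
  forall s, T s -> exists l : seq nat,
    [/\ uniq l, size l = b s & forall n, (n \in l) = T (rcons s n)].

Definition tree_path (T : pred (seq nat)) (p : nat -> nat) : Prop :=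
  forall n, T (mkseq p n).

Definition seq_fun_le (h : seq nat -> nat) (c : nat -> nat) : Prop :=
  turing_le (fun n => h (CodeSeq.decode n)) c.

(* Depends only on the degrees of [d] and [c]. *)
Definition PA_over (d c : nat -> nat) : Prop :=
  forall (T : pred (seq nat)) (b : seq nat -> nat),
    is_tree T -> infinite_set [set s | T s] -> branching T b ->
    seq_fun_le (fun s => nat_of_bool (T s)) c -> seq_fun_le b c ->
    exists p, tree_path T p /\ turing_le p d.

Record scott_ideal (I : set tdegree) : Prop := {
  scott_nonempty : I !=set0;
  scott_proper : I <> setT;
  scott_join : forall f g, I (deg f) -> I (deg g) -> I (deg (tjoin f g));
  scott_down : forall f g, turing_le f g -> I (deg g) -> I (deg f);
  scott_PA : forall c, I (deg c) -> exists d, I (deg d) /\ PA_over d c }.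

(* A field structure on nat isomorphic to the algebraic closure of the        *)
(* rationals, given by transporting [algC] along a bijection, with computable *)
(* operations.                                                                *)
Record presentation := Presentation {
  elt : nat -> algC;
  idx : algC -> nat;
  eltK : cancel elt idx;
  idxK : cancel idx elt;
  add_computable : computable2 (fun i j => idx (elt i + elt j)%R);
  mul_computable : computable2 (fun i j => idx (elt i * elt j)%R) }.

(* The field generated by [x] over the rationals; recall that [y / 0 = 0]. *)
Definition Qadj (x : algC) : set algC :=
  [set y | exists p q : {poly rat},
             y = ((map_poly ratr p).[x] / (map_poly ratr q).[x])%R].

(* [K] is normal over the rationals: all conjugates over the rationals of an  *)
(* element of [K] are in [K].                                                 *)
Definition normalQ (K : set algC) : Prop :=
  forall x y, K x -> root (minCpoly x) y -> K y.

Record tower (Q : presentation) := Tower {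
  gen : nat -> nat;
  gen_computable : computable gen;
  tower_field := fun n => Qadj (elt Q (gen n));
  tower0 : tower_field 0 = [set x | x \in Crat];
  tower_sub : forall n, tower_field n `<=` tower_field n.+1;
  tower_normal : forall n, normalQ (tower_field n);
  tower_cover : \bigcup_n tower_field n = setT }.

Definition is_automorphism (f : algC -> algC) : Prop :=
  [/\ zmod_morphism f, GRing.monoid_morphism f & bijective f].

Record autQ := AutQ {
  autQ_fun :> algC -> algC;
  autQP : is_automorphism autQ_fun }.

HB.instance Definition _ := gen_eqMixin autQ.
HB.instance Definition _ := gen_choiceMixin autQ.

Lemma autQ_ext (f g : autQ) : f =1 g -> f = g.
Proof.
case: f g => [f fP] [g gP] /= /funext fg; move: fP; rewrite fg => fP.
by congr AutQ; exact: Prop_irrelevance.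
Qed.

Fact idQ_subproof : is_automorphism id.
Proof. by split=> //; exists id. Qed.

Fact compQ_subproof (f g : autQ) : is_automorphism (f \o g).
Proof.
case: f g => [f [fB [f1 fM] fbij]] [g [gB [g1 gM] gbij]] /=; split.
- by move=> x y /=; rewrite gB fB.
- by split=> [|x y] /=; rewrite ?g1 ?f1 ?gM ?fM.
- exact: bij_comp.
Qed.

Fact invQ_subproof (f : autQ) :
  {h : algC -> algC | [/\ is_automorphism h, cancel f h & cancel h f]}.
Proof.
case: f => [f [fB [f1 fM] fbij]] /=; apply: cid.
case: (fbij) => h fK hK; exists h; split=> //; split.
- by move=> x y; rewrite -[RHS]fK fB !hK.
- by split=> [|x y]; rewrite -[RHS]fK ?f1 ?fM ?hK.
- by exists f.
Qed.

Definition autQ_one : autQ := AutQ idQ_subproof.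
Definition autQ_mul (f g : autQ) : autQ := AutQ (compQ_subproof f g).
Definition autQ_inv (f : autQ) : autQ :=
  let: exist h hP := invQ_subproof f in AutQ (let: And3 hA _ _ := hP in hA).

Lemma autQ_mulA : associative autQ_mul.
Proof. by move=> f g h; exact: autQ_ext. Qed.

Lemma autQ_mul1 : left_id autQ_one autQ_mul.
Proof. by move=> f; exact: autQ_ext. Qed.

Lemma autQ_mulV : left_inverse autQ_one autQ_inv autQ_mul.
Proof.
by move=> f; apply: autQ_ext => x /=; rewrite /autQ_inv; case: invQ_subproof => h [].
Qed.

Lemma autQ_mulr1 : right_id autQ_one autQ_mul.
Proof. by move=> f; exact: autQ_ext. Qed.

Lemma autQ_mulrV : right_inverse autQ_one autQ_inv autQ_mul.
Proof.
by move=> f; apply: autQ_ext => x /=; rewrite /autQ_inv; case: invQ_subproof => h [].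
Qed.

HB.instance Definition _ := isGroup.Build autQ
  autQ_mulA autQ_mul1 autQ_mulr1 autQ_mulV autQ_mulrV.

Definition aut_deg (Q : presentation) (F : tower Q) (f : autQ) : tdegree :=
  deg (fun n => idx Q (f (elt Q (gen F n.+1)))).

Definition AutI (Q : presentation) (F : tower Q) (I : set tdegree) : set autQ :=
  [set f | I (aut_deg F f)].

(* First-order formulas in the language of groups, with parameters from [P]   *)
(* as additional constants and with de Bruijn variables.                      *)
Inductive term (P : Type) : Type :=
| Var of nat
| Par of P
| One
| Mul of term P & term P
| Inv of term P.

Inductive formula (P : Type) : Type :=
| Eq of term P & term P
| Neg of formula P
| And of formula P & formula P
| Or of formula P & formula P
| Ex of formula P
| All of formula P.

Fixpoint term_closed P (n : nat) (t : term P) : bool :=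
  match t with
  | Var i => i < n
  | Par _ | One => true
  | Mul t u => term_closed n t && term_closed n u
  | Inv t => term_closed n t
  end.

Fixpoint formula_closed P (n : nat) (phi : formula P) : bool :=
  match phi with
  | Eq t u => term_closed n t && term_closed n u
  | Neg phi => formula_closed n phi
  | And phi psi | Or phi psi => formula_closed n phi && formula_closed n psi
  | Ex phi | All phi => formula_closed n.+1 phi
  end.

Definition sentence P (phi : formula P) : bool := formula_closed 0 phi.

Fixpoint term_val (G : groupType) P (par : P -> G) (e : seq G) (t : term P) : G :=
  match t with
  | Var i => nth 1%g e i
  | Par p => par p
  | One => 1%g
  | Mul t u => (term_val par e t * term_val par e u)%g
  | Inv t => (term_val par e t)^-1%g
  end.

(* Satisfaction in the subgroup of [G] with underlying set [D]. *)
Fixpoint sat (G : groupType) (D : set G) P (par : P -> G) (e : seq G)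
    (phi : formula P) : Prop :=
  match phi with
  | Eq t u => term_val par e t = term_val par e u
  | Neg phi => ~ sat D par e phi
  | And phi psi => sat D par e phi /\ sat D par e psi
  | Or phi psi => sat D par e phi \/ sat D par e psi
  | Ex phi => exists2 x, D x & sat D par (x :: e) phi
  | All phi => forall x, D x -> sat D par (x :: e) phi
  end.

Fixpoint quantifier_free P (phi : formula P) : bool :=
  match phi with
  | Eq _ _ => true
  | Neg phi => quantifier_free phi
  | And phi psi | Or phi psi => quantifier_free phi && quantifier_free psi
  | Ex _ | All _ => false
  end.

Fixpoint prenex P (phi : formula P) : bool :=
  match phi with
  | Ex phi | All phi => prenex phi
  | _ => quantifier_free phi
  end.

Fixpoint neg_free P (phi : formula P) : bool :=
  match phi with
  | Eq _ _ => true
  | Neg _ => false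
  | And phi psi | Or phi psi => neg_free phi && neg_free psi
  | Ex phi | All phi => neg_free phi
  end.

Definition positive P (phi : formula P) : bool := prenex phi && neg_free phi.

Fixpoint qf_negative P (phi : formula P) : bool :=
  match phi with
  | Neg (Eq _ _) => true
  | And phi psi | Or phi psi => qf_negative phi && qf_negative psi
  | _ => false
  end.

Definition separated P (phi : formula P) : Prop :=
  positive phi \/
  exists alpha beta, [/\ phi = And alpha beta, positive alpha & qf_negative beta].

(* A block of quantifiers is an iteration of [Ex] or [All], possibly empty. *)
Fixpoint sigma_separated P (n : nat) (phi : formula P) : Prop :=
  if n is m.+1 then
    exists k beta, phi = iter k (@Ex P) beta /\ pi_separated m beta
  else separated phi
with pi_separated P (n : nat) (phi : formula P) : Prop :=
  if n is m.+1 then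
    exists k beta, phi = iter k (@All P) beta /\ sigma_separated m beta
  else separated phi.

(* Main.v *)
(* In Aut(Qbar), a profinite group, positive formulas define closed sets.  An  *)
(* automorphism f is coded by the function i |-> index of f(element i); the    *)
(* codes form a computably bounded Pi_1 class.  By induction on a positive     *)
(* formula one gets a recursively enumerable, monotone set of tuples of finite *)
(* restrictions which refute it: an existential quantifier becomes a bounded   *)
(* search by compactness, and a universal one a search over the finite maps    *)
(* that extend to an automorphism.  The latter are recursively enumerable: a   *)
(* certificate gives a generator z of a normal field, an image r of z, and a   *)
(* polynomial of which z is a root and that has no factor of smaller degree    *)
(* among the finitely many with coefficients below an explicit bound.  Since a *)
(* path through a computably bounded tree can be found in any Scott ideal, the *)
(* same refutations decide the truth of the formula in Aut_I(Qbar), so that    *)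
(* positive formulas are absolute.  A block of universal quantifiers over a    *)
(* separated formula defines the intersection of a closed set with an open     *)
(* one, and the open condition is witnessed by finite data, which can be added *)
(* to the tree for the closed one.                                             *)
From HB Require Import structures.
Require Import Defs.
From mathcomp Require Import all_boot all_order all_algebra all_field.
From mathcomp Require Import zify ring.
From mathcomp Require Import boolp classical_sets functions cardinality.

Set Implicit Arguments.
Unset Strict Implicit.
Unset Printing Implicit Defensive.

Import Order.TTheory GRing.Theory Num.Theory.

Local Open Scope nat_scope.
Local Open Scope classical_set_scope.

(** * Recursive functions with an oracle, and Turing ideals *)

(** Code an automorphism f by its action on indices, [index_map], and let J be the set of functions
    whose degree lies in I. The values of f on the generators lie in J exactly when its whole code
    does ([full_ideal]), so Aut_I is [AutJ Q J]; the set of all functions gives the whole group in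
    the same way. Both sets are instances of [path_ideal]: Turing ideals with a path through every
    infinite finitely branching tree that is effective in them together with its branching. For a
    Scott ideal this is [path_ideal_scott], for all functions it is König's lemma,
    [path_ideal_setT]. The plan is to characterise truth by a condition on finite strings that does
    not mention the ideal.

    For positive formulas the condition is [refute_correct]: the formula holds at e exactly when no
    restriction of e lies in the enumerable monotone set [refute]. For an existential quantifier,
    the codes of automorphisms form a closed class below a fixed computable bound ([full_bound]), so
    the absence of a refutation yields an infinite tree, and a path in the ideal is the desired
    witness ([co_re_aut], [ex_refute_correct]). For a universal quantifier, the automorphisms in the
    ideal are dense ([autJ_dense]), so it is enough to enumerate the finite strings that extend to
    some automorphism ([extendibleP]); the certificates rest on [conj_cert_root].

    In a Sigma_2-separated sentence the universal block over the negative part is the negation of a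
    positive existential formula, hence an open condition on the outer variables. Once finite data
    that settle it are guessed, the rest is a search for a path in a closed class that respects
    these data ([sat_separated]). This too is independent of the ideal, and the negation of the
    sentence follows at once. *)

Local Notation natrec b h n := (nat_rect (fun=> _) b h n).

Section Recursive.
Variable O : nat -> nat.

Definition recursive n (f : seq nat -> nat) : Prop :=
  exists e, forall xs, size xs = n -> eval O e xs (f xs).

Lemma eq_recursive n f g :
  (forall xs, size xs = n -> f xs = g xs) -> recursive n f -> recursive n g.
Proof. by move=> fg [e eP]; exists e => xs sxs; rewrite -fg //; apply: eP. Qed.

Lemma recursive_zero n : recursive n (fun=> 0).
Proof. by exists Zero => xs _; constructor. Qed.

Lemma recursive_proj n i : i < n -> recursive n (fun xs => nth 0 xs i).
Proof. by move=> lin; exists (Proj i) => xs sxs; constructor; rewrite sxs. Qed.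

Lemma recursive_comp n (gs : seq (seq nat -> nat)) f :
  recursive (size gs) f -> (forall i, i < size gs -> recursive n (nth (fun=> 0) gs i)) ->
  recursive n (fun xs => f [seq g xs | g <- gs]).
Proof.
case=> e eP gsP; suff [hs hsP] : exists hs, forall xs, size xs = n ->
    evals O hs xs [seq g xs | g <- gs].
  by exists (Comp e hs) => xs sxs; econstructor; [exact: hsP | apply: eP; rewrite size_map].
elim: gs {f e eP} gsP => [|g gs IHgs] gsP; first by exists [::] => xs _; constructor.
have [hs hsP] := IHgs (fun i => gsP i.+1).
have [h hP] := gsP 0 isT.
by exists (h :: hs) => xs sxs; constructor; [exact: hP | exact: hsP].
Qed.

Lemma recursive_comp1 n f g :
  recursive 1 f -> recursive n g -> recursive n (fun xs => f [:: g xs]).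
Proof. by move=> fP gP; apply: (recursive_comp (gs := [:: g]) fP); case. Qed.

Lemma recursive_comp2 n f g h :
  recursive 2 f -> recursive n g -> recursive n h ->
  recursive n (fun xs => f [:: g xs; h xs]).
Proof. by move=> fP gP hP; apply: (recursive_comp (gs := [:: g; h]) fP); case=> [|[]]. Qed.

Lemma recursive_drop2 n f :
  recursive n f -> recursive n.+2 (fun xs => f (behead (behead xs))).
Proof.
move=> fP; pose gs := [seq (fun xs : seq nat => nth 0 xs i.+2) | i <- iota 0 n].
apply: (@eq_recursive _ (fun xs => f [seq g xs | g <- gs])).
  move=> [|x [|y xs]] //= [sxs]; congr f; rewrite -map_comp.
  by apply: (@eq_from_nth _ 0); rewrite size_map size_iota // => i lin;
    rewrite (nth_map 0) ?size_iota // nth_iota.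
apply: recursive_comp => [|i]; rewrite size_map size_iota // => lin.
rewrite (nth_map 0) ?size_iota // nth_iota // add0n.
exact: recursive_proj.
Qed.

(** [Prec] recurses on its first argument only, so it is composed with [N] followed by all the
    projections. *)
Lemma recursive_natrec n N b h :
  recursive n N -> recursive n b -> recursive n.+2 h ->
  recursive n (fun xs => natrec (b xs) (fun k r => h (k :: r :: xs)) (N xs)).
Proof.
move=> [eN NP] [eb bP] [eh hP].
pose ps := [seq Proj i | i <- iota 0 n].
exists (Comp (Prec eb eh) (eN :: ps)) => xs sxs.
apply: (@eval_Comp _ _ _ _ (N xs :: xs)).
  constructor; first exact: NP.
  rewrite {}/ps -{}sxs -[X in evals _ _ _ X](mkseq_nth 0) /mkseq.
  have : all (fun i => i < size xs) (iota 0 (size xs)).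
    by apply/allP=> i; rewrite mem_iota.
  elim: (iota _ _) => [|i s IHs] /=; first by constructor.
  by case/andP=> lti /IHs; constructor => //; constructor.
elim: (N xs) => [|k IHk] /=; first by constructor; apply: bP.
by econstructor; [exact: IHk | apply: hP; rewrite /= sxs].
Qed.

Lemma recursive_mu n p m : recursive n.+1 p ->
  (forall xs, size xs = n -> p (m xs :: xs) = 0) ->
  (forall xs k, size xs = n -> k < m xs -> p (k :: xs) != 0) ->
  recursive n m.
Proof.
move=> [e eP] pm0 pmN; exists (Mu e) => xs sxs.
(* The rule for [Mu] wants the values below the minimum written as successors, hence the
   predecessor. *)
apply: (@eval_Mu _ _ _ _ (fun k => (p (k :: xs)).-1)).
  by rewrite -(pm0 xs) //; apply: eP; rewrite /= sxs.
by move=> k ltkm; rewrite prednK ?lt0n ?pmN //; apply: eP; rewrite /= sxs.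
Qed.

Lemma recursive_oracle n f : recursive n f -> recursive n (fun xs => O (f xs)).
Proof.
move=> fP; apply: (@recursive_comp1 n (fun xs => O (head 0 xs))) fP.
by exists Oracle => -[|x []] // _; constructor.
Qed.

Lemma recursive_succ n f : recursive n f -> recursive n (fun xs => (f xs).+1).
Proof.
move=> fP; apply: (@recursive_comp1 n (fun xs => (head 0 xs).+1)) fP.
by exists Succ => -[|x []] // _; constructor.
Qed.

Lemma recursive_const n k : recursive n (fun=> k).
Proof. by elim: k => [|k IHk]; [exact: recursive_zero | exact: recursive_succ]. Qed.

Lemma recursive_pred n f : recursive n f -> recursive n (fun xs => (f xs).-1).
Proof.
move=> fP; apply: eq_recursive (recursive_natrec fP (recursive_zero n)
  (@recursive_proj n.+2 0 isT)) => xs _ /=.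
by elim: (f xs).
Qed.

Section Binary.
Variables (n : nat) (f g : seq nat -> nat).
Hypotheses (fP : recursive n f) (gP : recursive n g).

Lemma recursive_add : recursive n (fun xs => f xs + g xs).
Proof.
apply: eq_recursive (recursive_natrec gP fP
  (recursive_succ (@recursive_proj n.+2 1 isT))) => xs _ /=.
by elim: (g xs) => [|k /= ->]; rewrite ?addn0 ?addnS.
Qed.

Lemma recursive_sub : recursive n (fun xs => f xs - g xs).
Proof.
apply: eq_recursive (recursive_natrec gP fP
  (recursive_pred (@recursive_proj n.+2 1 isT))) => xs _ /=.
by elim: (g xs) => [|k /= ->]; rewrite ?subn0 ?subnS.
Qed.
End Binary.

Lemma recursive_mul n f g :
  recursive n f -> recursive n g -> recursive n (fun xs => f xs * g xs).
Proof.
move=> fP gP; apply: eq_recursive (recursive_natrec gP (recursive_zero n)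
  (recursive_add (@recursive_proj n.+2 1 isT) (recursive_drop2 fP))) => xs _ /=.
by elim: (g xs) => [|k /= ->]; rewrite ?muln0 ?mulnS // addnC.
Qed.

Lemma recursive_exp2 n f : recursive n f -> recursive n (fun xs => 2 ^ f xs).
Proof.
move=> fP; apply: eq_recursive (recursive_natrec fP (recursive_const n 1)
  (recursive_add (@recursive_proj n.+2 1 isT) (@recursive_proj n.+2 1 isT))) => xs _ /=.
by elim: (f xs) => [|k /= ->]; rewrite ?expn0 // expnS mul2n addnn.
Qed.

Definition dist x y := (x - y) + (y - x).

Lemma dist_eq0 x y : (dist x y == 0) = (x == y).
Proof. by rewrite /dist addn_eq0 !subn_eq0 eqn_leq. Qed.

Lemma recursive_dist n f g :
  recursive n f -> recursive n g -> recursive n (fun xs => dist (f xs) (g xs)).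
Proof. by move=> fP gP; apply: recursive_add; apply: recursive_sub. Qed.

End Recursive.

(* [npair] is a bijection for which [CodeSeq.code (a :: s)] is the successor of *)
(* [npair a (CodeSeq.code s)].                                                  *)
Definition npair a b := (2 ^ a * b.*2.+1).-1.

Lemma npairS a b : (npair a b).+1 = 2 ^ a * b.*2.+1.
Proof. by rewrite /npair prednK // muln_gt0 expn_gt0. Qed.

Lemma npair_code a b : (npair a b).+1 = CodeSeq.code (a :: CodeSeq.decode b).
Proof. by rewrite npairS /= CodeSeq.decodeK. Qed.

Lemma npair_inj a b c d : npair a b = npair c d -> a = c /\ b = d.
Proof.
move=> /(congr1 S); rewrite !npair_code => /(can_inj CodeSeq.codeK) [-> bd].
by rewrite -(CodeSeq.decodeK b) bd CodeSeq.decodeK.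
Qed.

Definition nfst n := head 0 (CodeSeq.decode n.+1).
Definition nsnd n := CodeSeq.code (behead (CodeSeq.decode n.+1)).

Lemma nfstK a b : nfst (npair a b) = a.
Proof. by rewrite /nfst npair_code CodeSeq.codeK. Qed.

Lemma nsndK a b : nsnd (npair a b) = b.
Proof. by rewrite /nsnd npair_code CodeSeq.codeK /= CodeSeq.decodeK. Qed.

Lemma npairK n : npair (nfst n) (nsnd n) = n.
Proof.
apply: succn_inj; rewrite npairS /nfst /nsnd.
by have := CodeSeq.decodeK n.+1; case: (CodeSeq.decode n.+1).
Qed.

Lemma nsnd_le n : nsnd n <= n.
Proof.
rewrite -[leqRHS]npairK -ltnS npairS; apply: leq_trans (leq_pmull _ _); last first.
  by rewrite expn_gt0.
by rewrite ltnS -addnn leq_addr.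
Qed.

Section RecursivePair.
Variables (O : nat -> nat) (n : nat).

Lemma recursive_npair f g :
  recursive O n f -> recursive O n g -> recursive O n (fun xs => npair (f xs) (g xs)).
Proof.
move=> fP gP; apply: recursive_pred; apply: recursive_mul; first exact: recursive_exp2.
apply: recursive_succ; apply: (@eq_recursive _ _ (fun xs => g xs + g xs)).
  by move=> xs _; rewrite addnn.
exact: recursive_add.
Qed.

End RecursivePair.

(** [t k a] is a product over b up to k that vanishes exactly when some [npair a b] equals k; by
    [nsnd_le] this range of b suffices. Minimisation over a then finds the first component. *)
Lemma recursive_nfst O n f : recursive O n f -> recursive O n (fun xs => nfst (f xs)).
Proof.
move=> fP; apply: (@recursive_comp1 _ n (fun xs => nfst (head 0 xs))) fP.
pose t (k a : nat) := natrec 1 (fun b r => r * dist (npair a b) k) k.+1.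
have tP k a : (t k a == 0) = (nfst k == a).
  rewrite /t; apply/idP/eqP => [|<-].
    elim: k.+1 => //= b IHb; rewrite muln_eq0 => /orP[/IHb //|].
    by rewrite dist_eq0 => /eqP<-; rewrite nfstK.
  have : nsnd k < k.+1 by rewrite ltnS nsnd_le.
  elim: k.+1 => //= b IHb; rewrite ltnS leq_eqVlt => /orP[/eqP<-|/IHb/eqP->//].
  by rewrite npairK muln_eq0 dist_eq0 eqxx orbT.
apply: (@recursive_mu _ 1 (fun xs => t (nth 0 xs 1) (nth 0 xs 0))).
- apply: eq_recursive (recursive_natrec (n := 2)
    (recursive_succ (recursive_proj O (isT : 1 < 2)))
    (recursive_const _ _ 1) (recursive_mul (recursive_proj O (isT : 1 < 4))
     (recursive_dist (recursive_npair (recursive_proj O (isT : 2 < 4))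
       (recursive_proj O (isT : 0 < 4))) (recursive_proj O (isT : 3 < 4))))) => //.
- by move=> [|x []] //= _; apply/eqP; rewrite tP.
- by move=> [|x []] //= a _; rewrite tP neq_ltn orbC => ->.
Qed.

Lemma recursive_nsnd O n f : recursive O n f -> recursive O n (fun xs => nsnd (f xs)).
Proof.
move=> fP; apply: (@recursive_comp1 _ n (fun xs => nsnd (head 0 xs))) fP.
apply: (@recursive_mu _ 1 (fun xs => dist (npair (nfst (nth 0 xs 1)) (nth 0 xs 0)) (nth 0 xs 1))).
- apply: recursive_dist; last exact: recursive_proj.
  by apply: recursive_npair; [apply: recursive_nfst|]; apply: recursive_proj.
- by move=> [|x []] //= _; apply/eqP; rewrite dist_eq0 npairK.
- move=> [|x []] //= b _; rewrite dist_eq0; apply: contraL => /eqP.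
  by move=> prx; rewrite -[x in nsnd x]prx nsndK ltnn.
Qed.

Record turing_ideal (J : set (nat -> nat)) : Prop := TuringIdeal {
  ideal_nonempty : J !=set0;
  ideal_join : forall f g, J f -> J g -> J (tjoin f g);
  ideal_down : forall f g, turing_le f g -> J g -> J f }.

Section Ideal.
Variables (J : set (nat -> nat)) (JP : turing_ideal J).

Lemma ideal_recursive O f : J O -> recursive O 1 (fun xs => f (head 0 xs)) -> J f.
Proof.
move=> JO [e eP]; apply: (ideal_down JP) JO; exists e => x.
by have := eP [:: x] erefl.
Qed.

Lemma tjoin_even f g x : tjoin f g (x + x) = f x.
Proof. by rewrite /tjoin addnn odd_double doubleK. Qed.

Lemma tjoin_odd f g x : tjoin f g (x + x).+1 = g x.
Proof. by rewrite /tjoin addnn /= odd_double /= uphalf_double. Qed.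

Lemma recursive_joinl f g n h :
  recursive (tjoin f g) n h -> recursive (tjoin f g) n (fun xs => f (h xs)).
Proof.
move=> hP; apply: (@eq_recursive _ _ (fun xs => tjoin f g (h xs + h xs))).
  by move=> xs _; rewrite tjoin_even.
by apply: recursive_oracle; apply: recursive_add.
Qed.

Lemma recursive_joinr f g n h :
  recursive (tjoin f g) n h -> recursive (tjoin f g) n (fun xs => g (h xs)).
Proof.
move=> hP; apply: (@eq_recursive _ _ (fun xs => tjoin f g (h xs + h xs).+1)).
  by move=> xs _; rewrite tjoin_odd.
by apply: recursive_oracle; apply: recursive_succ; apply: recursive_add.
Qed.

Lemma recursive_head O : recursive O 1 (head 0).
Proof. by apply: eq_recursive (recursive_proj O (isT : 0 < 1)) => -[]. Qed.
Hint Resolve recursive_head : core.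

(** A zero oracle lies in the ideal, being computable from any member of it. *)
Lemma ideal_computable f : recursive (fun=> 0) 1 (fun xs => f (head 0 xs)) -> J f.
Proof.
have [O JO] := ideal_nonempty JP; apply: ideal_recursive.
by apply: (ideal_recursive JO); apply: recursive_zero.
Qed.

Lemma ideal_id : J id.
Proof. exact: ideal_computable. Qed.

Lemma ideal_const k : J (fun=> k).
Proof. by apply: ideal_computable; apply: recursive_const. Qed.

Lemma ideal_succ : J S.
Proof. by apply: ideal_computable; apply: recursive_succ. Qed.

Lemma ideal_pred : J predn.
Proof. by apply: ideal_computable; apply: recursive_pred. Qed.

Lemma ideal_nfst : J nfst.
Proof. by apply: ideal_computable; apply: recursive_nfst. Qed.

Lemma ideal_nsnd : J nsnd.
Proof. by apply: ideal_computable; apply: recursive_nsnd. Qed.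

Lemma ideal_comp f g : J f -> J g -> J (f \o g).
Proof.
move=> Jf Jg; apply: (ideal_recursive (ideal_join JP Jf Jg)).
exact/recursive_joinl/recursive_joinr.
Qed.

Lemma ideal_npair f g : J f -> J g -> J (fun x => npair (f x) (g x)).
Proof.
move=> Jf Jg; apply: (ideal_recursive (ideal_join JP Jf Jg)).
by apply: recursive_npair; [apply: recursive_joinl | apply: recursive_joinr].
Qed.

Lemma ideal_natrec b s : J b -> J s ->
  J (fun x => natrec (b (nfst x)) (fun k r => s (npair (nfst x) (npair k r))) (nsnd x)).
Proof.
move=> Jb Js; apply: (ideal_recursive (ideal_join JP Jb Js)).
apply: eq_recursive (recursive_natrec (recursive_nsnd (recursive_head _))
  (recursive_joinl (recursive_nfst (recursive_head _)))
  (recursive_joinr (recursive_npair (recursive_nfst (recursive_proj _ (isT : 2 < 3)))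
    (recursive_npair (recursive_proj _ (isT : 0 < 3)) (recursive_proj _ (isT : 1 < 3)))))) => //.
Qed.

Lemma ideal_mu d m : J d -> (forall x, d (npair x (m x)) = 0) ->
  (forall x k, k < m x -> d (npair x k) != 0) -> J m.
Proof.
move=> Jd dm0 dmN; apply: (ideal_recursive Jd).
apply: (@recursive_mu _ 1 (fun xs => d (npair (nth 0 xs 1) (nth 0 xs 0)))).
- by apply: recursive_oracle; apply: recursive_npair; apply: recursive_proj.
- by move=> [|x []].
- by move=> [|x []] //= k _; apply: dmN.
Qed.

Lemma ideal_computable2 f : computable2 f -> J (fun x => f (nfst x) (nsnd x)).
Proof.
case=> e eP; apply: ideal_computable.
apply: (@recursive_comp2 _ 1 (fun xs => f (nth 0 xs 0) (nth 0 xs 1))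
  (fun xs => nfst (head 0 xs)) (fun xs => nsnd (head 0 xs))).
- by exists e => -[|x [|y []]].
- exact: recursive_nfst.
- exact: recursive_nsnd.
Qed.

Lemma ideal_computable1 f : computable f -> J f.
Proof. by case=> e eP; apply: ideal_computable; exists e => -[|x []]. Qed.

End Ideal.

(** * Functions on encoded types computable from a member of an ideal *)

(** Injectivity is enough: functions on codes are only constrained at codes of actual elements. *)
Class encoding (A : Type) := Encoding { enc : A -> nat; enc_inj : injective enc }.

#[export] Instance enc_nat : encoding nat := Encoding (@inj_id nat).

Fact enc_bool_subproof : injective nat_of_bool.
Proof. by case=> [] []. Qed.
#[export] Instance enc_bool : encoding bool := Encoding enc_bool_subproof.

Fact enc_prod_subproof A B (eA : encoding A) (eB : encoding B) :
  injective (fun x : A * B => npair (enc x.1) (enc x.2)).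
Proof. by move=> [a b] [c d] /= /npair_inj[/(@enc_inj _ eA)-> /(@enc_inj _ eB)->]. Qed.
#[export] Instance enc_prod A B (eA : encoding A) (eB : encoding B) :
  encoding (A * B) := Encoding (@enc_prod_subproof A B eA eB).

Fact enc_seq_subproof A (eA : encoding A) :
  injective (fun s : seq A => CodeSeq.code (map enc s)).
Proof. by apply: inj_comp (can_inj CodeSeq.codeK) (inj_map enc_inj). Qed.
#[export] Instance enc_seq A (eA : encoding A) : encoding (seq A) :=
  Encoding (@enc_seq_subproof A eA).

Lemma enc_pair A B (eA : encoding A) (eB : encoding B) (a : A) (b : B) :
  enc (a, b) = npair (enc a) (enc b).
Proof. by []. Qed.

Lemma enc_cons A (eA : encoding A) (a : A) s : enc (a :: s) = (npair (enc a) (enc s)).+1.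
Proof. by rewrite npairS. Qed.

Lemma enc_decode n : enc (CodeSeq.decode n) = n.
Proof. by rewrite /enc /= map_id CodeSeq.decodeK. Qed.

Lemma decode_enc (s : seq nat) : CodeSeq.decode (enc s) = s.
Proof. by rewrite /enc /= map_id CodeSeq.codeK. Qed.

Lemma size_enc A (eA : encoding A) (s : seq A) : size s <= enc s.
Proof.
elim: s => // a s IHs; rewrite enc_cons ltnS; apply: (leq_trans IHs).
by rewrite -[X in X <= _](nsndK (enc a)) nsnd_le.
Qed.

Section Calculus.
Variables (J : set (nat -> nat)) (JP : turing_ideal J).

(* Effective in [J]: computed, through the codes, by a member of [J]. *)
Definition eff A B {eA : encoding A} {eB : encoding B} (f : A -> B) : Prop :=
  exists2 F, J F & forall a, F (enc a) = enc (f a).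

Lemma ideal_eff (f : nat -> nat) : J f <-> eff f.
Proof.
split=> [Jf|[F JF FE]]; first by exists f.
by have <- : F = f by apply/funext.
Qed.

Lemma eq_eff A B {eA : encoding A} {eB : encoding B} (f g : A -> B) :
  f =1 g -> eff f -> eff g.
Proof. by move=> fg [F JF FE]; exists F => // a; rewrite FE fg. Qed.

Lemma eff_comp A B C {eA : encoding A} {eB : encoding B} {eC : encoding C}
    (f : B -> C) (g : A -> B) : eff f -> eff g -> eff (fun a => f (g a)).
Proof.
move=> [F JF FE] [G JG GE]; exists (F \o G); first exact: ideal_comp.
by move=> a /=; rewrite GE FE.
Qed.

Lemma ideal_case c f : J f -> J (fun n => if n is k.+1 then f k else c).
Proof.
move=> Jf; have := ideal_natrec JP (ideal_const JP c)
  (ideal_comp JP Jf (ideal_comp JP (ideal_nfst JP) (ideal_nsnd JP))).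
move=> /(ideal_comp JP)/(_ (ideal_npair JP (ideal_id JP) (ideal_id JP))).
set G := (X in J X); suff -> : G = fun n => if n is k.+1 then f k else c by [].
by apply/funext => n; rewrite /G /comp nsndK; case: n => //= n; rewrite nsndK nfstK.
Qed.

Section Domain.
Context {A : Type} {eA : encoding A}.

Lemma eff_id : eff (fun a : A => a).
Proof. by exists id => //; apply: ideal_id. Qed.

Lemma eff_const B {eB : encoding B} (b : B) : eff (fun _ : A => b).
Proof. by exists (fun=> enc b) => //; apply: ideal_const. Qed.

Lemma eff_pair B C {eB : encoding B} {eC : encoding C} (f : A -> B) (g : A -> C) :
  eff f -> eff g -> eff (fun a => (f a, g a)).
Proof.
move=> [F JF FE] [G JG GE]; exists (fun n => npair (F n) (G n)); first exact: ideal_npair.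
by move=> a; rewrite FE GE.
Qed.

Lemma eff_comp2 B C D {eB : encoding B} {eC : encoding C} {eD : encoding D}
    (h : B -> C -> D) (f : A -> B) (g : A -> C) :
  eff (fun p : B * C => h p.1 p.2) -> eff f -> eff g -> eff (fun a => h (f a) (g a)).
Proof. by move=> hP fP gP; apply: (eff_comp hP (eff_pair fP gP)). Qed.

Lemma eff_comp3 B1 B2 B3 D {e1 : encoding B1} {e2 : encoding B2} {e3 : encoding B3}
    {eD : encoding D} (h : B1 -> B2 -> B3 -> D) (f : A -> B1) (g : A -> B2) (k : A -> B3) :
  eff (fun p : B1 * (B2 * B3) => h p.1 p.2.1 p.2.2) -> eff f -> eff g -> eff k ->
  eff (fun a => h (f a) (g a) (k a)).
Proof. by move=> hP fP gP kP; apply: (eff_comp hP (eff_pair fP (eff_pair gP kP))). Qed.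

Lemma eff_fst B C {eB : encoding B} {eC : encoding C} (f : A -> B * C) :
  eff f -> eff (fun a => (f a).1).
Proof.
apply: (@eff_comp _ _ _ _ _ _ fst); exists nfst; first exact: ideal_nfst.
by move=> [b c]; rewrite enc_pair nfstK.
Qed.

Lemma eff_snd B C {eB : encoding B} {eC : encoding C} (f : A -> B * C) :
  eff f -> eff (fun a => (f a).2).
Proof.
apply: (@eff_comp _ _ _ _ _ _ snd); exists nsnd; first exact: ideal_nsnd.
by move=> [b c]; rewrite enc_pair nsndK.
Qed.

Lemma eff_cons B {eB : encoding B} (f : A -> B) g :
  eff f -> eff g -> eff (fun a => f a :: g a).
Proof.
move=> fP gP; move: (eff_pair fP gP); apply: (@eff_comp _ _ _ _ _ _ (fun p : B * seq B => p.1 :: p.2)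
  (fun a => (f a, g a))).
by exists S => [|[b s]]; [exact: ideal_succ | rewrite enc_cons].
Qed.

Lemma eff_head B {eB : encoding B} (d : B) (f : A -> seq B) :
  eff f -> eff (fun a => head d (f a)).
Proof.
apply: (@eff_comp _ _ _ _ _ _ (head d)).
exists (fun n => if n is k.+1 then nfst k else enc d).
  by apply: ideal_case; apply: ideal_nfst.
by move=> [|b s] //; rewrite enc_cons nfstK.
Qed.

Lemma eff_behead B {eB : encoding B} (f : A -> seq B) :
  eff f -> eff (fun a => behead (f a)).
Proof.
apply: (@eff_comp _ _ _ _ _ _ behead).
exists (fun n => if n is k.+1 then nsnd k else 0).
  by apply: ideal_case; apply: ideal_nsnd.
by move=> [|b s] //; rewrite enc_cons nsndK.
Qed.

Lemma eff_enc B {eB : encoding B} (f : A -> B) : eff f -> eff (fun a => enc (f a)).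
Proof. by case=> F JF FE; exists F. Qed.

Lemma eff_nat_of_bool (f : A -> bool) : eff f -> eff (fun a => nat_of_bool (f a)).
Proof. exact: eff_enc. Qed.

Lemma eff_decode (f : A -> nat) : eff f -> eff (fun a => CodeSeq.decode (f a)).
Proof. by case=> F JF FE; exists F => // a; rewrite enc_decode FE. Qed.

Lemma eff_succ (f : A -> nat) : eff f -> eff (fun a => (f a).+1).
Proof. by apply: (@eff_comp _ _ _ _ _ _ S); exact: (ideal_eff _).1 (ideal_succ JP). Qed.

Lemma eff_pred (f : A -> nat) : eff f -> eff (fun a => (f a).-1).
Proof. by apply: (@eff_comp _ _ _ _ _ _ predn); exact: (ideal_eff _).1 (ideal_pred JP). Qed.

Lemma eff_nfst (f : A -> nat) : eff f -> eff (fun a => nfst (f a)).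
Proof. by apply: (@eff_comp _ _ _ _ _ _ nfst); exact: (ideal_eff _).1 (ideal_nfst JP). Qed.

Lemma eff_nsnd (f : A -> nat) : eff f -> eff (fun a => nsnd (f a)).
Proof. by apply: (@eff_comp _ _ _ _ _ _ nsnd); exact: (ideal_eff _).1 (ideal_nsnd JP). Qed.

Lemma eff_natrec B {eB : encoding B} (N : A -> nat) (b : A -> B) h :
  eff N -> eff b -> eff (fun p : A * (nat * B) => h p.1 p.2.1 p.2.2) ->
  eff (fun a => natrec (b a) (fun k r => h a k r) (N a)).
Proof.
move=> [FN JN NE] [Fb Jb bE] [Fh Jh hE].
exists ((fun x => natrec (Fb (nfst x)) (fun k r => Fh (npair (nfst x) (npair k r))) (nsnd x))
  \o (fun x => npair (id x) (FN x))) => [|a /=].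
  apply: (ideal_comp JP (ideal_natrec JP Jb Jh)).
  exact: (ideal_npair JP (ideal_id JP) JN).
rewrite nfstK nsndK NE bE.
by elim: (N a) => //= k ->; apply: (hE (a, (k, _))).
Qed.

End Domain.

Section Nat.
Context {A : Type} {eA : encoding A}.
Implicit Types (f g : A -> nat) (b c : A -> bool).

Lemma eff_if B {eB : encoding B} c (f g : A -> B) :
  eff c -> eff f -> eff g -> eff (fun a => if c a then f a else g a).
Proof.
move=> cP fP gP; apply: (@eq_eff _ _ _ _
  (fun a => natrec (g a) (fun _ _ => f a) (nat_of_bool (c a)))).
  by move=> a; case: (c a).
apply: eff_natrec => //.
by apply: (eff_comp fP); apply: eff_fst; apply: eff_id.
Qed.

Lemma eff_eq0 f : eff f -> eff (fun a => f a == 0).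
Proof.
apply: (@eff_comp _ _ _ _ _ _ (fun n => n == 0)).
exists (fun n => if n is k.+1 then 0 else 1) => [|[]] //.
by apply: ideal_case; apply: ideal_const.
Qed.

End Nat.

Section Nat.
Context {A : Type} {eA : encoding A}.
Implicit Types (f g : A -> nat) (b c : A -> bool).

Lemma eff_neg b : eff b -> eff (fun a => ~~ b a).
Proof. by move=> bP; apply: eq_eff (eff_if bP (eff_const _) (eff_const _)). Qed.

Lemma eff_and b c : eff b -> eff c -> eff (fun a => b a && c a).
Proof. by move=> bP cP; apply: eq_eff (eff_if bP cP (eff_const _)). Qed.

Lemma eff_or b c : eff b -> eff c -> eff (fun a => b a || c a).
Proof. by move=> bP cP; apply: eq_eff (eff_if bP (eff_const _) cP). Qed.

Lemma eff_add f g : eff f -> eff g -> eff (fun a => f a + g a).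
Proof.
move=> fP gP; apply: eq_eff (eff_natrec (h := fun _ _ r => r.+1) gP fP _).
  by move=> a; elim: (g a) => [|k /= ->]; rewrite ?addn0 ?addnS.
by apply: eff_succ; do 2!apply: eff_snd; apply: eff_id.
Qed.

Lemma eff_sub f g : eff f -> eff g -> eff (fun a => f a - g a).
Proof.
move=> fP gP; apply: eq_eff (eff_natrec (h := fun _ _ r => r.-1) gP fP _).
  by move=> a; elim: (g a) => [|k /= ->]; rewrite ?subn0 ?subnS.
by apply: eff_pred; do 2!apply: eff_snd; apply: eff_id.
Qed.

End Nat.

Section Nat.
Context {A : Type} {eA : encoding A}.
Implicit Types (f g : A -> nat) (b c : A -> bool).

Lemma eff_mul f g : eff f -> eff g -> eff (fun a => f a * g a).
Proof.
move=> fP gP; apply: eq_eff (eff_natrec (h := fun a _ r => r + f a) gP (eff_const 0) _).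
  by move=> a; elim: (g a) => [|k /= ->]; rewrite ?muln0 ?mulnS // addnC.
apply: eff_add; first by do 2!apply: eff_snd; apply: eff_id.
by apply: (eff_comp fP); apply: eff_fst; apply: eff_id.
Qed.

End Nat.

Section Nat.
Context {A : Type} {eA : encoding A}.
Implicit Types (f g : A -> nat) (b c : A -> bool).

Lemma eff_leq f g : eff f -> eff g -> eff (fun a => f a <= g a).
Proof. by move=> fP gP; apply: eq_eff (eff_eq0 (eff_sub fP gP)). Qed.

Lemma eff_eq (B : eqType) {eB : encoding B} (f g : A -> B) :
  eff f -> eff g -> eff (fun a => f a == g a).
Proof.
move=> /eff_enc fP /eff_enc gP.
apply: eq_eff (eff_eq0 (eff_add (eff_sub fP gP) (eff_sub gP fP))) => a.
by rewrite addn_eq0 !subn_eq0 -eqn_leq (inj_eq enc_inj).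
Qed.

End Nat.

Section Nat.
Context {A : Type} {eA : encoding A}.
Implicit Types (f g : A -> nat) (b c : A -> bool).

Lemma eff_all_iota N (P : A -> nat -> bool) :
  eff N -> eff (fun p : A * nat => P p.1 p.2) -> eff (fun a => all (P a) (iota 0 (N a))).
Proof.
move=> NP PP; apply: eq_eff (eff_natrec (h := fun a k r => r && P a k) NP (eff_const true) _).
  by move=> a; elim: (N a) => // k IHk; rewrite [LHS]/= IHk -[k.+1]addn1 iotaD all_cat /= andbT.
apply: eff_and; first by do 2!apply: eff_snd; apply: eff_id.
apply: (eff_comp2 PP); first by apply: eff_fst; apply: eff_id.
by apply: eff_fst; apply: eff_snd; apply: eff_id.
Qed.

Lemma eff_count_iota N (P : A -> nat -> bool) :
  eff N -> eff (fun p : A * nat => P p.1 p.2) -> eff (fun a => count (P a) (iota 0 (N a))).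
Proof.
move=> NP PP; apply: eq_eff (eff_natrec (h := fun a k r => r + P a k) NP (eff_const 0) _).
  by move=> a; elim: (N a) => // k IHk; rewrite [LHS]/= IHk -[k.+1]addn1 iotaD count_cat /= addn0.
apply: eff_add; first by do 2!apply: eff_snd; apply: eff_id.
apply: eff_nat_of_bool; apply: (eff_comp2 PP).
  by apply: eff_fst; apply: eff_id.
by apply: eff_fst; apply: eff_snd; apply: eff_id.
Qed.

Lemma eff_iter B {eB : encoding B} (N : A -> nat) (b : A -> B) h :
  eff N -> eff b -> eff (fun p : A * B => h p.1 p.2) ->
  eff (fun a => iter (N a) (h a) (b a)).
Proof.
move=> NP bP hP; apply: eq_eff (eff_natrec (h := fun a _ r => h a r) NP bP _).
  by move=> a; elim: (N a) => //= k ->.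
apply: (eff_comp2 hP); first by apply: eff_fst; apply: eff_id.
by do 2!apply: eff_snd; apply: eff_id.
Qed.


End Nat.

Section Seq.
Context {A : Type} {eA : encoding A} {B : Type} {eB : encoding B} (d : B).
Implicit Types s t : A -> seq B.

(** The fold is a bounded iteration on pairs of remaining list and accumulator. The code of the list
    is at least its length ([size_enc]), so it serves as the number of steps; the surplus steps are
    idle because the list is then empty. *)
Lemma eff_foldl C {eC : encoding C} s (h : A -> C -> B -> C) z :
  eff (fun p : A * (C * B) => h p.1 p.2.1 p.2.2) -> eff z -> eff s ->
  eff (fun a => foldl (h a) (z a) (s a)).
Proof.
move=> hP zP sP.
pose step a (r : seq B * C) :=
  if @enc _ (enc_seq eB) r.1 == 0 then r else (behead r.1, h a r.2 (head d r.1)).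
apply: (@eq_eff _ _ _ _ (fun a => (iter (enc (s a)) (step a) (s a, z a)).2)).
  move=> a; suff stepP n l c : size l <= n -> (iter n (step a) (l, c)).2 = foldl (h a) c l.
    exact/stepP/size_enc.
  elim: n l c => [|n IHn] [|x l] c // ltln.
    by have -> : iter n.+1 (step a) ([::], c) = ([::], c) by elim: n.+1 => //= k ->.
  by rewrite iterSr /= -IHn // {2}/step [fst _]/= enc_cons.
apply: eff_snd; apply: eff_iter; [exact: eff_enc | exact: eff_pair |].
apply: eff_if; first by apply: eff_eq0; apply: eff_enc; apply: eff_fst; apply: eff_snd; apply: eff_id.
  by apply: eff_snd; apply: eff_id.
apply: eff_pair; first by apply: eff_behead; apply: eff_fst; apply: eff_snd; apply: eff_id.
apply: (eff_comp3 hP); first by apply: eff_fst; apply: eff_id.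
  by do 2!apply: eff_snd; apply: eff_id.
by apply: (eff_head d); apply: eff_fst; apply: eff_snd; apply: eff_id.
Qed.

End Seq.

Section Seq.
Context {A : Type} {eA : encoding A} {B : Type} {eB : encoding B} (d : B).
Implicit Types s t : A -> seq B.

Lemma eff_rev s : eff s -> eff (fun a => rev (s a)).
Proof.
move=> sP; apply: (@eq_eff _ _ _ _ (fun a => foldl (fun l x => x :: l) [::] (s a))).
  by move=> a; rewrite /rev; elim: (s a) [::] => //= x l IHl l'; rewrite IHl.
apply: (eff_foldl d) => //; last exact: eff_const.
by apply: eff_cons; [do 2!apply: eff_snd | apply: eff_fst; apply: eff_snd]; apply: eff_id.
Qed.

Lemma eff_foldr C {eC : encoding C} s (h : A -> B -> C -> C) z :
  eff (fun p : A * (B * C) => h p.1 p.2.1 p.2.2) -> eff z -> eff s ->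
  eff (fun a => foldr (h a) (z a) (s a)).
Proof.
move=> hP zP sP.
apply: (@eq_eff _ _ _ _ (fun a => foldl (fun c b => h a b c) (z a) (rev (s a)))).
  by move=> a; rewrite foldl_rev.
apply: (eff_foldl d) => //; last exact: eff_rev.
apply: (eff_comp3 hP); first by apply: eff_fst; apply: eff_id.
  by do 2!apply: eff_snd; apply: eff_id.
by apply: eff_fst; apply: eff_snd; apply: eff_id.
Qed.

End Seq.

Section Seq.
Context {A : Type} {eA : encoding A} {B : Type} {eB : encoding B} (d : B).
Implicit Types s t : A -> seq B.

Lemma eff_size s : eff s -> eff (fun a => size (s a)).
Proof.
move=> sP; apply: (@eq_eff _ _ _ _ (fun a => foldr (fun _ n => n.+1) 0 (s a))).
  by move=> a; elim: (s a) => //= x l ->.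
apply: (eff_foldr d) => //; last exact: eff_const.
by apply: eff_succ; do 2!apply: eff_snd; apply: eff_id.
Qed.

Lemma eff_cat s t : eff s -> eff t -> eff (fun a => s a ++ t a).
Proof.
move=> sP tP; apply: (@eq_eff _ _ _ _ (fun a => foldr cons (t a) (s a))).
  by move=> a; elim: (s a) => //= x l ->.
apply: (eff_foldr d) => //.
by apply: eff_cons; [apply: eff_fst; apply: eff_snd | do 2!apply: eff_snd]; apply: eff_id.
Qed.

Lemma eff_rcons s f : eff s -> eff f -> eff (fun a => rcons (s a) (f a)).
Proof.
move=> sP fP; apply: (@eq_eff _ _ _ _ (fun a => s a ++ [:: f a])).
  by move=> a; rewrite cats1.
by apply: eff_cat => //; apply: eff_cons => //; apply: eff_const.
Qed.

Lemma eff_nth s (n : A -> nat) : eff s -> eff n -> eff (fun a => nth d (s a) (n a)).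
Proof.
move=> sP nP; apply: (@eq_eff _ _ _ _ (fun a => head d (iter (n a) behead (s a)))).
  move=> a; elim: (n a) (s a) => [|k IHk] l; first by rewrite nth0.
  by rewrite iterSr IHk nth_behead.
apply: (eff_head d); apply: eff_iter => //.
by apply: eff_behead; apply: eff_snd; apply: eff_id.
Qed.


End Seq.

Lemma eff_mkseq A {eA : encoding A} B {eB : encoding B} (d : B)
    (f : A -> nat -> B) (n : A -> nat) :
  eff n -> eff (fun p : A * nat => f p.1 p.2) -> eff (fun a => mkseq (f a) (n a)).
Proof.
move=> nP fP; apply: eq_eff (eff_natrec (h := fun a k r => rcons r (f a k)) nP (eff_const [::]) _).
  by move=> a; elim: (n a) => //= k ->; rewrite mkseqS.
apply: (eff_rcons d); first by do 2!apply: eff_snd; apply: eff_id.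
apply: (eff_comp2 fP); first by apply: eff_fst; apply: eff_id.
by apply: eff_fst; apply: eff_snd; apply: eff_id.
Qed.

Lemma eff_take A {eA : encoding A} (s : A -> seq nat) (n : A -> nat) :
  eff s -> eff n -> eff (fun a => take (n a) (s a)).
Proof.
(* The double truncated subtraction is the minimum of [size (s a)] and [n a]. *)
move=> sP nP; apply: (@eq_eff _ _ _ _
  (fun a => mkseq (nth 0 (s a)) (size (s a) - (size (s a) - n a)))).
  move=> a; rewrite -minnE; apply: (@eq_from_nth _ 0).
    by rewrite size_mkseq size_take_min minnC.
  move=> i; rewrite size_mkseq => lti; rewrite nth_mkseq // nth_take //.
  by rewrite (leq_trans lti) ?geq_minr.
apply: (eff_mkseq 0).
  by apply: eff_sub; [|apply: eff_sub => //]; apply: (eff_size 0).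
apply: (eff_nth 0); last by apply: eff_snd; apply: eff_id.
by apply: (eff_comp sP); apply: eff_fst; apply: eff_id.
Qed.

End Calculus.

(** * Recursively enumerable relations and paths through trees *)

(** A hook of [eff_tac], redefined once the operations of the presentation are known to be
    effective. *)
Ltac eff_user := fail.

Ltac eff_tac := repeat (cbv beta; lazymatch goal with
 | |- eff _ (fun a => a) => apply: eff_id
 | |- eff _ (fun _ => ?b) => apply: eff_const
 | |- eff _ (fun a => (@?f a, @?g a)) => apply: eff_pair
 | |- eff _ (fun a => fst (@?f a)) => apply: eff_fst
 | |- eff _ (fun a => snd (@?f a)) => apply: eff_snd
 | |- eff _ (fun a => cons (@?f a) (@?g a)) => apply: eff_cons
 | |- eff _ (fun a => head ?d (@?f a)) => apply: eff_head
 | |- eff _ (fun a => behead (@?f a)) => apply: eff_behead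
 | |- eff _ (fun a => (@?f a).+1) => apply: eff_succ
 | |- eff _ (fun a => (@?f a).-1) => apply: eff_pred
 | |- eff _ (fun a => nfst (@?f a)) => apply: eff_nfst
 | |- eff _ (fun a => nsnd (@?f a)) => apply: eff_nsnd
 | |- eff _ (fun a => CodeSeq.decode (@?f a)) => apply: eff_decode
 | |- eff _ (fun a => enc (@?f a)) => apply: eff_enc
 | |- eff _ (fun a => nat_of_bool (@?f a)) => apply: eff_nat_of_bool
 | |- eff _ (fun a => if _ then _ else _) => apply: eff_if
 | |- eff _ (fun a => ~~ (@?f a)) => apply: eff_neg
 | |- eff _ (fun a => andb (@?f a) (@?g a)) => apply: eff_and
 | |- eff _ (fun a => orb (@?f a) (@?g a)) => apply: eff_or
 | |- eff _ (fun a => addn (@?f a) (@?g a)) => apply: eff_add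
 | |- eff _ (fun a => subn (@?f a) (@?g a)) => apply: eff_sub
 | |- eff _ (fun a => muln (@?f a) (@?g a)) => apply: eff_mul
 | |- eff _ (fun a => leq (@?f a) (@?g a)) => apply: eff_leq
 | |- eff _ (fun a => eq_op (@?f a) (@?g a)) => apply: eff_eq
 | |- eff _ (fun a => all (@?P a) (iota 0 (@?N a))) => apply: eff_all_iota
 | |- eff _ (fun a => count (@?P a) (iota 0 (@?N a))) => apply: eff_count_iota
 | |- eff _ (fun a => nat_rect ?m (@?P a) (@?h a) (@?N a)) => apply: eff_natrec
 | |- eff _ (fun a => size (@?f a)) => apply: (eff_size _ 0)
 | |- eff _ (fun a => cat (@?f a) (@?g a)) => apply: (eff_cat _ 0)
 | |- eff _ (fun a => @nth nat ?d (@?f a) (@?g a)) => apply: (eff_nth _ d)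
 | |- eff _ (fun a => @nth (seq nat) ?d (@?f a) (@?g a)) => apply: (eff_nth _ d)
 | |- eff _ (fun a => @mkseq nat (@?f a) (@?g a)) => apply: (eff_mkseq _ 0)
 | |- eff _ (fun a => take (@?f a) (@?g a)) => apply: eff_take
 | |- eff _ (fun a => foldr (@?f a) (@?g a) (@?h a)) => apply: (eff_foldr _ 0)
 | |- turing_ideal _ => assumption
 | |- @eff ?J ?A ?B ?eA ?eB ?f =>
   first [assumption | eff_user | progress change (@eff J A B eA eB (fun a : A => f a))]
 end).

Section Enumerable.
Variables (J : set (nat -> nat)) (JP : turing_ideal J).

(* Relations that are recursively enumerable in a member of [J]. *)
Definition re A {eA : encoding A} (P : A -> Prop) : Prop :=
  exists D : A -> nat -> bool,
    eff J (fun p : A * nat => D p.1 p.2) /\ forall a, P a <-> exists w, D a w.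

Lemma re_iff A {eA : encoding A} (P P' : A -> Prop) :
  (forall a, P a <-> P' a) -> re P -> re P'.
Proof. by move=> PP' [D [DP PD]]; exists D; split=> // a; rewrite -PP'. Qed.

Lemma re_comp A B {eA : encoding A} {eB : encoding B} (P : B -> Prop) (f : A -> B) :
  re P -> eff J f -> re (fun a => P (f a)).
Proof.
move=> [D [DP PD]] fP; exists (fun a => D (f a)); split=> //.
apply: (eff_comp2 JP DP); last by eff_tac.
by apply: (eff_comp JP fP); eff_tac.
Qed.

Section Domain.
Context {A : Type} {eA : encoding A}.
Implicit Types P : A -> Prop.

Lemma re_dec (b : A -> bool) : eff J b -> re (fun a => b a).
Proof.
move=> bP; exists (fun a _ => b a); split; first by apply: (eff_comp JP bP); eff_tac.
by move=> a; split=> [ba|[]//]; exists 0.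
Qed.

Lemma re_eq B {eB : encoding B} (f g : A -> B) :
  eff J f -> eff J g -> re (fun a => f a = g a).
Proof.
move=> fP gP; apply: (@re_iff _ _ (fun a => enc (f a) == enc (g a))).
  by move=> a; split=> [/eqP fg|->//]; apply: enc_inj fg.
by apply: re_dec; eff_tac.
Qed.

Lemma re_neq B {eB : encoding B} (f g : A -> B) :
  eff J f -> eff J g -> re (fun a => f a <> g a).
Proof.
move=> fP gP; apply: (@re_iff _ _ (fun a => enc (f a) != enc (g a))).
  move=> a; split=> [/eqP encN fg|fgN]; first by apply: encN; rewrite fg.
  by apply/eqP => encfg; apply: fgN; apply: enc_inj encfg.
by apply: re_dec; eff_tac.
Qed.

Lemma re_and P Q : re P -> re Q -> re (fun a => P a /\ Q a).
Proof.
move=> [D [DP PD]] [E [EP QE]].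
exists (fun a w => D a (nfst w) && E a (nsnd w)); split.
  by eff_tac; [apply: (eff_comp2 JP DP) | apply: (eff_comp2 JP EP)]; eff_tac.
move=> a; rewrite PD QE; split=> [[[v Dv] [w Ew]]|[w /andP[Dw Ew]]].
  by exists (npair v w); rewrite nfstK nsndK Dv.
by split; eexists; eassumption.
Qed.

Lemma re_or P Q : re P -> re Q -> re (fun a => P a \/ Q a).
Proof.
move=> [D [DP PD]] [E [EP QE]].
exists (fun a w => D a w || E a w); split; first by eff_tac.
move=> a; rewrite PD QE; split=> [[[v Dv]|[w Ew]]|[w /orP[Dw|Ew]]].
- by exists v; rewrite Dv.
- by exists w; rewrite Ew orbT.
- by left; exists w.
- by right; exists w.
Qed.

Lemma re_ex (P : A -> nat -> Prop) :
  re (fun p : A * nat => P p.1 p.2) -> re (fun a => exists n, P a n).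
Proof.
move=> [D [DP PD]]; exists (fun a w => D (a, nfst w) (nsnd w)); split.
  by apply: (eff_comp2 JP DP); eff_tac.
move=> a; split=> [[n /(PD (a, n)) [w Dw]]|[w Dw]].
  by exists (npair n w); rewrite nfstK nsndK.
by exists (nfst w); apply/(PD (a, _)); exists (nsnd w).
Qed.

Lemma re_ex_seq (P : A -> seq nat -> Prop) :
  re (fun p : A * seq nat => P p.1 p.2) -> re (fun a => exists s, P a s).
Proof.
move=> PP; apply: (@re_iff _ _ (fun a => exists n, P a (CodeSeq.decode n))).
  move=> a; split=> [[n Pn]|[s Ps]]; first by exists (CodeSeq.decode n).
  by exists (enc s); rewrite decode_enc.
apply: re_ex; apply: (@re_comp _ _ _ _ (fun p => P p.1 p.2)
  (fun p : A * nat => (p.1, CodeSeq.decode p.2))) => //.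
by eff_tac.
Qed.

(** Finitely many witnesses have a common bound, and that bound is the single witness for the
    bounded quantifier. *)
Lemma re_ball (N : A -> nat) (P : A -> nat -> Prop) :
  eff J N -> re (fun p : A * nat => P p.1 p.2) ->
  re (fun a => forall i, i < N a -> P a i).
Proof.
move=> NP [D [DP PD]].
pose E (a : A) (W i : nat) := ~~ all (fun w => ~~ D (a, i) w) (iota 0 W).
exists (fun a W => all (E a W) (iota 0 (N a))); split.
  rewrite /E; eff_tac; first by apply: (eff_comp JP NP); eff_tac.
  by apply: (eff_comp2 JP DP); eff_tac.
move=> a; split=> [Pa|[W /allP EW] i ltiN]; last first.
  have /EW/allPn[w _] : i \in iota 0 (N a) by rewrite mem_iota.
  by rewrite negbK => Dw; apply/(PD (a, i)); exists w.
elim: (N a) Pa => [|n IHn] Pa; first by exists 0.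
have [W /allP EW] := IHn (fun i ltin => Pa i (ltnW ltin)).
have [w Dw] := (PD (a, n)).1 (Pa n (ltnSn n)).
exists (maxn W w.+1); apply/allP => i; rewrite mem_iota add0n /= ltnS leq_eqVlt.
case/orP=> [/eqP->|ltin]; apply/allPn.
  by exists w; rewrite ?negbK // mem_iota add0n leq_max leqnn orbT.
have /EW/allPn[v vW Dv] : i \in iota 0 n by rewrite mem_iota.
exists v => //; move: vW; rewrite !mem_iota !add0n /= => vW.
by rewrite leq_max vW.
Qed.

End Domain.

(** Search for the least code of a pair of a value and a witness for it, and keep the value. *)
Lemma ideal_uniformize (P : nat -> nat -> Prop) :
  re (fun p : nat * nat => P p.1 p.2) -> (forall n, exists m, P n m) ->
  exists2 f, J f & forall n, P n (f n).
Proof.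
move=> [D [DP PD]] exP.
pose d n w := D (n, nfst w) (nsnd w).
have exd n : exists w, d n w.
  have [m /(PD (n, m))[w Dw]] := exP n.
  by exists (npair m w); rewrite /d nfstK nsndK.
exists (fun n => nfst (ex_minn (exd n))) => [|n]; last first.
  by case: ex_minnP => w dw _; apply/(PD (n, nfst w)); exists (nsnd w).
apply: (ideal_comp JP (ideal_nfst JP)).
have Jd : J (fun x : nat => nat_of_bool (~~ d (nfst x) (nsnd x))).
  by apply/ideal_eff; rewrite /d; eff_tac; apply: (eff_comp2 JP DP); eff_tac.
apply: (ideal_mu JP Jd) => [n|n k]; rewrite nfstK nsndK; case: ex_minnP => w dw minw.
  by rewrite dw.
by rewrite ltnNge; apply: contra; case dk: (d n k) => // _; apply: minw.
Qed.

Lemma ideal_graph (f : nat -> nat) :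
  re (fun p : nat * nat => f p.1 = p.2) -> J f.
Proof.
move=> fP; have [n|g Jg fg] := @ideal_uniformize (fun n m => f n = m) fP; first by exists (f n).
by have -> : f = g by apply/funext.
Qed.

End Enumerable.

Ltac re_tac := repeat (cbv beta; lazymatch goal with
 | |- re _ (fun a => (@?P a) /\ (@?Q a)) => apply: re_and
 | |- re _ (fun a => (@?P a) \/ (@?Q a)) => apply: re_or
 | |- re _ (fun a => exists n : nat, @?P a n) => apply: re_ex
 | |- re _ (fun a => exists s : seq nat, @?P a s) => apply: re_ex_seq
 | |- re _ (fun a => forall i, is_true (i < @?N a) -> @?P a i) => apply: re_ball
 | |- re _ (fun a => is_true (@?b a)) => apply: re_dec
 | |- re _ (fun a => not (@?f a = @?g a)) => apply: re_neq
 | |- re _ (fun a => @?f a = @?g a) => apply: re_eq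
 | |- eff _ _ => progress eff_tac
 | |- _ => assumption
 end).

(** * Larger ideals, and ideals that contain paths through their trees *)

Lemma eff_sub_ideal (J J' : set (nat -> nat)) A B (eA : encoding A) (eB : encoding B)
  (f : A -> B) : J `<=` J' -> eff J f -> eff J' f.
Proof. by move=> JJ' [F JF FE]; exists F => //; apply: JJ'. Qed.

Lemma re_sub_ideal (J J' : set (nat -> nat)) A (eA : encoding A) (P : A -> Prop) :
  J `<=` J' -> re J P -> re J' P.
Proof. by move=> JJ' [D [DP PD]]; exists D; split=> //; apply: eff_sub_ideal DP. Qed.

(** What the functions of a Scott ideal and the set of all functions have in common; every later
    result about satisfaction is proved for an arbitrary such ideal, so that it can be applied to
    both. *)
Record path_ideal (J : set (nat -> nat)) : Prop := PathIdeal {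
  path_turing :> turing_ideal J;
  path_exists : forall (T : pred (seq nat)) (b : seq nat -> nat),
    is_tree T -> infinite_set [set s | T s] -> branching T b ->
    eff J T -> eff J b -> exists2 p, J p & tree_path T p }.

Lemma path_ideal_scott I : scott_ideal I -> path_ideal [set f | I (deg f)].
Proof.
move=> hI.
have JP : turing_ideal [set f | I (deg f)].
  split=> /=; [|exact: scott_join hI|exact: scott_down hI].
  have [[D [f Df]] ID] := scott_nonempty hI; exists f => /=.
  suff -> : deg f = TDegree (ex_intro _ f Df) by [].
  by move: (ex_intro _ _ _) ID; rewrite Df => p _; congr TDegree; apply: Prop_irrelevance.
split=> // T b treeT infT brT JT Jb.
have {JT} Jt : [set f | I (deg f)] (fun n => nat_of_bool (T (CodeSeq.decode n))).
  by apply/ideal_eff; eff_tac; apply: (eff_comp JP JT); eff_tac.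
have {Jb} Jb : [set f | I (deg f)] (fun n => b (CodeSeq.decode n)).
  by apply/ideal_eff; apply: (eff_comp JP Jb); eff_tac.
(* A function PA over the join of tree and branching is needed, since both must be computable from
   one oracle. *)
have [d [Id dPA]] := scott_PA hI (ideal_join JP Jt Jb).
have [||p [Tp pd]] := dPA T b treeT infT brT; last by exists p => //; apply: scott_down pd Id.
  have [e eP] := recursive_joinl (recursive_head (tjoin (fun n => nat_of_bool (T (CodeSeq.decode n)))
    (fun n => b (CodeSeq.decode n)))).
  by exists e => x; apply: (eP [:: x]).
have [e eP] := recursive_joinr (recursive_head (tjoin (fun n => nat_of_bool (T (CodeSeq.decode n)))
  (fun n => b (CodeSeq.decode n)))).
by exists e => x; apply: (eP [:: x]).
Qed.

Section Konig.
Variables (T : pred (seq nat)) (b : seq nat -> nat).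
Hypotheses (treeT : is_tree T) (infT : infinite_set [set s | T s]) (brT : branching T b).

(** The extensions of a node are the node itself and the extensions of its finitely many children,
    so one child has infinitely many. *)
Lemma konig_extend s : infinite_set [set t | T (s ++ t)] ->
  exists n, infinite_set [set t | T (rcons s n ++ t)].
Proof.
move=> infs; have Ts : T s.
  apply: contrapT => nTs; apply: infs; suff -> : [set t | T (s ++ t)] = set0 by [].
  by apply/seteqP; split=> t //= /treeT.
have [l [_ _ lT]] := brT Ts.
apply: contrapT => noext; apply: infs.
apply: (@sub_finite_set _ _ ([set [::]] `|` \bigcup_(n in [set` l])
    (cons n @` [set t | T (rcons s n ++ t)]))).
  move=> [|n t] /= Tt; [by left | right; exists n => /=; last by exists t; rewrite //= cat_rcons].
  by rewrite /= lT; apply: (@treeT _ t); rewrite cat_rcons.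
rewrite finite_setU; split=> //; apply: bigcup_finite => // n _.
by apply: finite_image; apply: contrapT => infn; apply: noext; exists n.
Qed.

Lemma konig : exists p, tree_path T p.
Proof.
have /choice[next nextP] s : exists n, infinite_set [set t | T (s ++ t)] ->
    infinite_set [set t | T (rcons s n ++ t)].
  have [infs|fins] := pselect (infinite_set [set t | T (s ++ t)]); last by exists 0.
  by have [n infn] := konig_extend infs; exists n.
pose S n := iter n (fun s => rcons s (next s)) [::].
exists (next \o S) => n; have -> : mkseq (next \o S) n = S n.
  by elim: n => //= n IHn; rewrite mkseqS IHn.
have : infinite_set [set t | T (S n ++ t)] by elim: n => //= n IHn; apply: nextP.
move=> infS; apply: contrapT => nTs; apply: infS.
suff -> : [set t | T (S n ++ t)] = set0 by [].
by apply/seteqP; split=> t //= /treeT.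
Qed.

End Konig.

Lemma path_ideal_setT : path_ideal setT.
Proof.
split=> [|T b treeT infT brT _ _]; first by split=> //; exists id.
by have [p Tp] := konig treeT infT brT; exists p.
Qed.

Definition bounded (B : nat -> nat) s := all (fun i => nth 0 s i <= B i) (iota 0 (size s)).

Lemma boundedP B s : reflect (forall i, i < size s -> nth 0 s i <= B i) (bounded B s).
Proof.
apply: (iffP allP) => sB i; last by rewrite mem_iota; apply: sB.
by move=> lti; apply: sB; rewrite mem_iota.
Qed.

Lemma eff_bounded (J : set (nat -> nat)) (JP : turing_ideal J) B A (eA : encoding A)
    (f : A -> seq nat) :
  J B -> eff J f -> eff J (fun a => bounded B (f a)).
Proof.
move=> JB fP; rewrite /bounded; eff_tac; first by apply: (eff_comp JP fP); eff_tac.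
by apply: (eff_comp JP ((ideal_eff _ _).1 JB)); eff_tac.
Qed.

Section CoEnumerable.
Variables (J : set (nat -> nat)) (JP : path_ideal J) (B : nat -> nat) (JB : J B).

(* The tree of the bounded sequences that are not refuted by a witness       *)
(* smaller than their length is decidable, as is its branching.              *)
Lemma co_re_path (R : seq nat -> Prop) :
  re J (fun s => ~ R s) -> (forall s t, R (s ++ t) -> R s) ->
  (forall n, exists s, [/\ size s = n, bounded B s & R s]) ->
  exists p, [/\ J p, forall n, R (mkseq p n) & forall i, p i <= B i].
Proof.
have JP' : turing_ideal J := JP.
move=> [D [DP RD]] Rcat Rn.
(* All prefixes are tested against all small witnesses, which makes [T] closed under prefixes. *)
pose T s := bounded B s && all (fun k => all (fun w => ~~ D (take k s) w)
   (iota 0 (size s).+1)) (iota 0 (size s).+1).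
have TP s : T s <-> bounded B s /\
    forall k w, k <= size s -> w <= size s -> ~~ D (take k s) w.
  split=> [/andP[Bs /allP Ds]|[Bs Ds]].
    split=> // k w lek lew; have /Ds/allP/(_ w) : k \in iota 0 (size s).+1 by rewrite mem_iota.
    by rewrite mem_iota; apply.
  apply/andP; split=> //; apply/allP => k; rewrite mem_iota => lek.
  by apply/allP => w; rewrite mem_iota => lew; apply: Ds.
have treeT : is_tree T.
  move=> s t /TP[/boundedP Bst Dst]; apply/TP; split.
    apply/boundedP => i lti; have := Bst i; rewrite nth_cat lti; apply.
    by rewrite size_cat ltn_addr.
  move=> k w lek lew; have := Dst k w; rewrite size_cat take_cat.
  rewrite ltn_neqAle lek andbT; case: eqP => [->|_] /=; last by apply; apply: leq_trans (leq_addr _ _).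
  by rewrite subnn take0 cats0 take_size; apply; apply: leq_trans (leq_addr _ _).
have RT s : bounded B s -> R s -> T s.
  move=> Bs Rs; apply/TP; split=> // k w _ _; apply/negP => Dk.
  have nRk : ~ R (take k s) by apply/RD; exists w.
  by apply/nRk/(Rcat _ (drop k s)); rewrite cat_take_drop.
have infT : infinite_set [set s | T s].
  move=> finT; apply: infinite_nat; rewrite (_ : [set: nat] = size @` [set s | T s]).
    exact: finite_image.
  by apply/seteqP; split=> // n _; have [s [sn Bs Rs]] := Rn n; exists s => //; apply: RT.
have TB s m : T (rcons s m) -> m <= B (size s).
  by move=> /TP[/boundedP/(_ (size s)) + _]; rewrite size_rcons nth_rcons ltnn eqxx; apply.
pose b s := count (fun m => T (rcons s m)) (iota 0 (B (size s)).+1).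
have brT : branching T b.
  move=> s Ts; exists [seq m <- iota 0 (B (size s)).+1 | T (rcons s m)]; split.
  - by rewrite filter_uniq ?iota_uniq.
  - by rewrite size_filter.
  - move=> m; rewrite mem_filter mem_iota add0n ltnS; apply/andP/idP => [[]//|Tm].
    by split=> //; apply: TB.
have jT : eff J T.
  rewrite /T; eff_tac; first by apply: eff_bounded => //; eff_tac.
  by apply: (eff_comp2 _ DP); eff_tac.
have jb : eff J b.
  rewrite /b; eff_tac; first by apply: (eff_comp _ ((ideal_eff _ _).1 JB)); eff_tac.
  by apply: (eff_comp _ jT) => //; apply: (eff_rcons _ 0); eff_tac.
have [p Jp Tp] := path_exists JP treeT infT brT jT jb.
exists p; split=> // [n|i]; last first.
  have /TP[/boundedP/(_ i) + _] := Tp i.+1.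
  by rewrite size_mkseq nth_mkseq // ltnSn; apply.
apply: contrapT => /RD[w Dw].
(* At length [maxn n w] the tree has tested the prefix of length n against the witness w. *)
have /TP[_ /(_ n w)] := Tp (maxn n w); rewrite size_mkseq leq_maxl leq_maxr => /(_ isT isT).
rewrite (_ : take n (mkseq p (maxn n w)) = mkseq p n) ?Dw //.
by rewrite /mkseq -map_take take_iota (minn_idPl (leq_maxl n w)).
Qed.

End CoEnumerable.

(** * Integer polynomials and conjugates *)

Section IntegerPolynomials.
Local Open Scope ring_scope.

(* Integers are represented as differences [t - M] with a common [M]; the    *)
(* coefficients come from [ts], followed by the leading coefficient [b].     *)
Definition zpoly (b : nat) (ts : seq nat) (M : nat) : {poly int} :=
  foldr (fun t p => (t%:Z - M%:Z)%:P + 'X * p) b%:Z%:P ts.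

Lemma coef_zpoly b ts M i :
  (zpoly b ts M)`_i =
    if (i < size ts)%N then (nth 0%N ts i)%:Z - M%:Z else if i == size ts then b%:Z else 0.
Proof.
elim: ts i => [|t ts IHts] i /=; first by rewrite coefC; case: eqP.
by rewrite coefD coefC coefXM; case: i => [|i] /=; rewrite ?addr0 ?add0r ?IHts.
Qed.

Lemma size_zpoly ts M : size (zpoly 1 ts M) = (size ts).+1.
Proof.
apply/eqP; rewrite eqn_leq; apply/andP; split.
  by apply/leq_sizeP => i lti; rewrite coef_zpoly ltnNge (ltnW lti) /= gtn_eqF.
rewrite ltnNge; apply/negP => /leq_sizeP/(_ _ (leqnn _)).
by rewrite coef_zpoly ltnn eqxx.
Qed.

Lemma monic_zpoly ts M : zpoly 1 ts M \is monic.
Proof. by rewrite monicE lead_coefE size_zpoly /= coef_zpoly ltnn eqxx. Qed.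

Lemma zpoly_repr b (p : {poly int}) d M :
  (forall i, (i < d)%N -> (`|(p`_i)%R| <= M)%N) -> p`_d = b%:Z -> (size p <= d.+1)%N ->
  exists ts, [/\ size ts = d, bounded (fun=> M + M)%N ts & p = zpoly b ts M].
Proof.
move=> pM pd sp; pose t i := `|(p`_i + M%:Z)%R|%N.
have tE i : (i < d)%N -> (t i)%:Z = p`_i + M%:Z.
  by move=> /pM; rewrite /t; lia.
exists (mkseq t d); split; first by rewrite size_mkseq.
  apply/boundedP => i; rewrite size_mkseq => ltid; rewrite nth_mkseq //.
  by have := pM _ ltid; have := tE _ ltid; lia.
apply/polyP => i; rewrite coef_zpoly size_mkseq.
case: ltngtP => [ltid|ltdi|->]; [|by rewrite nth_default // (leq_trans sp)|by []].
by rewrite nth_mkseq // tE // addrK.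
Qed.

Lemma zpoly_ex (p : {poly int}) : exists ts M, p = zpoly 0 ts M.
Proof.
have [ts [_ _ ->]] : exists ts, [/\ size ts = size p,
    bounded (fun=> (\max_(i < size p) `|(p`_i)%R|) + (\max_(i < size p) `|(p`_i)%R|))%N ts &
    p = zpoly 0 ts (\max_(i < size p) `|(p`_i)%R|)%N].
  apply: zpoly_repr => [i ltip||]; last exact: leqnSn.
    exact: (leq_bigmax (F := fun i : 'I_(size p) => `|(p`_i)%R|%N) (Ordinal ltip)).
  by rewrite nth_default.
by do 2!eexists.
Qed.

Lemma zpoly_monic_ex (p : {poly int}) : p \is monic ->
  exists ts M, bounded (fun=> M + M)%N ts /\ p = zpoly 1 ts M.
Proof.
move=> mp; set M := (\max_(i < (size p).-1) `|(p`_i)%R|)%N.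
have [ts [_ Bts ->]] : exists ts, [/\ size ts = (size p).-1, bounded (fun=> M + M)%N ts &
    p = zpoly 1 ts M].
  apply: zpoly_repr => [i ltip||]; last by rewrite prednK // size_poly_gt0 monic_neq0.
    exact: (leq_bigmax (F := fun i : 'I_(size p).-1 => `|(p`_i)%R|%N) (Ordinal ltip)).
  by rewrite -lead_coefE (monicP mp).
by exists ts, M.
Qed.

Definition zhorner (b : nat) ts M (x : algC) : algC := (map_poly intr (zpoly b ts M)).[x].

Lemma zhornerE b ts M x :
  zhorner b ts M x = foldr (fun t a => (t%:R - M%:R) + x * a) b%:R ts.
Proof.
rewrite /zhorner; elim: ts => [|t ts IHts] /=; first by rewrite map_polyC hornerC.
rewrite rmorphD rmorphM /= map_polyC map_polyX hornerD hornerM hornerC hornerX IHts.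
by rewrite /= rmorphB /=.
Qed.

Lemma zhorner_aut b ts M (nu : {rmorphism algC -> algC}) x :
  nu (zhorner b ts M x) = zhorner b ts M (nu x).
Proof.
rewrite /zhorner -horner_map -map_poly_comp; congr (_.[_]).
by apply: eq_map_poly => z /=; rewrite rmorph_int.
Qed.

Lemma pQtoC_int (p : {poly int}) :
  map_poly ratr (map_poly intr p : {poly rat}) = map_poly intr p :> {poly algC}.
Proof. by rewrite -map_poly_comp; apply: eq_map_poly => z /=; rewrite rmorph_int. Qed.

Lemma minCpoly_dvd_int (p : {poly int}) x :
  root (map_poly intr p) x = (minCpoly x %| map_poly intr p).
Proof. by have [q [-> _ qP]] := minCpolyP x; rewrite -pQtoC_int qP dvdp_map. Qed.

Lemma Aint_minCpoly x : x \in Aint ->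
  exists2 p : {poly int}, p \is monic & minCpoly x = map_poly intr p.
Proof.
rewrite unfold_in => /floorpP[p Dp]; exists p => //.
have := minCpoly_monic x; rewrite Dp !monicE lead_coef_map_inj //; last exact: intr_inj.
by rewrite -(eqr_int algC).
Qed.

(** If p is an integer polynomial of degree n with leading coefficient l and root x, then l^(n-1)
    p(x) is a monic integer polynomial in l x. The multiplier is the absolute value of l. *)
Lemma Aint_zmul x : exists2 k : nat, (0 < k)%N & k%:R * x \in Aint.
Proof.
have [p0 [Dp mp0] _] := minCpolyP x; have [p [a nz_a Dp0]] := rat_poly_scale p0.
have px : root (map_poly intr p) x.
  have := root_minCpoly x; rewrite Dp Dp0 linearZ /= rootZ ?pQtoC_int //.
  by rewrite fmorph_eq0 invr_eq0 intr_eq0.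
have nzp : p != 0.
  by apply: contraTneq mp0 => pz; rewrite Dp0 pz map_poly0 scaler0 monicE lead_coef0 eq_sym oner_eq0.
pose l := lead_coef p; have nzl : l != 0 by rewrite lead_coef_eq0.
pose n := (size p).-1; have sp : size p = n.+1 by rewrite /n prednK // size_poly_gt0.
have n0 : (0 < n)%N.
  rewrite -ltnS -sp -(size_map_inj_poly (f := intr : int -> algC)) ?rmorph0 //; last exact: intr_inj.
  apply: root_size_gt1 px; rewrite map_poly_eq0_id0 // intr_eq0 -/l //.
pose q := \poly_(i < n.+1) (if i == n then 1 else p`_i * l ^+ (n - i).-1).
have lq : q \is monic.
  by rewrite monicE lead_coef_poly ?eqxx.
have qx : root (map_poly intr q) (l%:~R * x).
  have sq : size (map_poly intr q : {poly algC}) = n.+1.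
    by rewrite size_map_inj_poly ?rmorph0 //; [rewrite size_poly_eq ?eqxx | exact: intr_inj].
  rewrite rootE horner_coef sq.
  apply/eqP; transitivity (l%:~R ^+ n.-1 * (map_poly intr p).[x]); last by rewrite (rootP px) mulr0.
  rewrite horner_coef size_map_inj_poly ?rmorph0 //; last exact: intr_inj.
  rewrite sp mulr_sumr; apply: eq_bigr => i _; rewrite !coef_map /= coef_poly ltn_ord exprMn.
  case: eqP => [->|/eqP nin].
    rewrite mul1r [p`_n](_ : _ = l) ?mulrA -?exprSr ?prednK //.
  have ltin : (i < n)%N by rewrite ltn_neqAle nin -ltnS ltn_ord.
  rewrite rmorphM rmorphXn /= -!mulrA [RHS]mulrCA; congr (_ * _); rewrite mulrA -exprD.
  by congr (_ ^+ _ * _); lia.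
have Al : l%:~R * x \in Aint.
  by apply: root_monic_Aint qx _ _; [exact: monic_map | apply/polyOverP => i; rewrite coef_map /= intr_int].
exists `|l|%N; first by rewrite absz_gt0.
by rewrite natr_absz; have [|] := ger0P l; rewrite // mulrNz mulNr rpredN.
Qed.

(** The point is that the roots are distinct. Let p be the rational minimal polynomial and g its gcd
    with its derivative. If x were a root of g, then p would divide its nonzero derivative, which
    has smaller degree; hence x is a root of p / g, so p divides the separable polynomial p / g. *)
Lemma minCpoly_roots x : exists rs, [/\ uniq rs, minCpoly x = \prod_(z <- rs) ('X - z%:P) &
  (size rs).+1 = size (minCpoly x)].
Proof.
have [rs Drs] := closed_field_poly_normal (minCpoly x).
rewrite (monicP (minCpoly_monic x)) scale1r in Drs.
exists rs; split=> //; last by rewrite Drs size_prod_XsubC.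
rewrite -separable_prod_XsubC -Drs.
have [p [Dp mp] pP] := minCpolyP x; rewrite Dp separable_map.
have nzp : p != 0 by rewrite monic_neq0.
have := make_separable nzp; set g := gcdp p _ => sep_pg.
suff p_pg : p %| p %/ g by apply: dvdp_separable p_pg sep_pg.
have := root_minCpoly x; rewrite Dp -{1}(divpK (dvdp_gcdl p p^`())) -/g rmorphM rootM.
rewrite !pP => /orP[//|/dvdp_trans/(_ (dvdp_gcdr _ _)) dvp'].
have sp1 : (1 < size p)%N by rewrite -(size_map_poly (ratr : rat -> algC)) -Dp size_minCpoly.
have nzp' : p^`() != 0.
  apply/eqP => /(congr1 (fun q : {poly rat} => q`_(size p).-2)); rewrite coef_deriv coef0.
  rewrite prednK ?subn_gt0; last by case: (size p) sp1 => [|[]].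
  rewrite -lead_coefE (monicP mp) => /eqP; rewrite -mulr_natr mul1r pnatr_eq0.
  by case: (size p) sp1 => [|[]].
by have := dvdp_leq nzp' dvp'; rewrite leqNgt lt_size_deriv.
Qed.


Lemma zhorner_dvd ts M x : zhorner 1 ts M x = 0 -> minCpoly x %| map_poly intr (zpoly 1 ts M).
Proof. by move=> /eqP; rewrite -minCpoly_dvd_int. Qed.

Lemma size_zpolyC ts M : size (map_poly intr (zpoly 1 ts M) : {poly algC}) = (size ts).+1.
Proof. by rewrite size_map_inj_poly ?rmorph0 ?size_zpoly //; apply: intr_inj. Qed.

(** Cauchy's bound: the lower coefficients have absolute value at most M, so beyond the bound the
    leading term x^d would exceed the sum of the d others. *)
Lemma root_zpoly_le ts M x : bounded (fun=> M + M)%N ts -> zhorner 1 ts M x = 0 ->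
  `|x| <= (size ts * M).+1%:R.
Proof.
move=> /boundedP tsM; rewrite /zhorner horner_coef size_zpolyC big_ord_recr /=.
rewrite coef_map coef_zpoly ltnn eqxx mul1r.
set d := size ts => /eqP; rewrite addr_eq0 eq_sym eqr_oppLR => /eqP xd.
have [|x1] := real_leP (normr_real x) (@realn algC (d * M).+1) => //.
have ge1 : 1 <= `|x| by apply: le_trans (ltW x1); rewrite ler1n.
have d0 : (0 < d)%N.
  by case: d xd x1 => // /eqP; rewrite big_ord0 oppr0 expr0 oner_eq0.
suff : `|x| ^+ d < `|x| ^+ d by rewrite ltxx.
apply: le_lt_trans (_ : (d * M)%:R * `|x| ^+ d.-1 < _); last first.
  rewrite -[X in _ < _ ^+ X](prednK d0) exprS ltr_pM2r ?exprn_gt0 ?(lt_le_trans ltr01) //.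
  by apply: lt_trans x1; rewrite ltr_nat.
rewrite -normrX xd normrN; apply: le_trans (ler_norm_sum _ _ _) _.
rewrite -[X in (X * M)%N]card_ord -sum_nat_const natr_sum mulr_suml; apply: ler_sum => i _.
rewrite normrM normrX; apply: ler_pM; [by []|by rewrite exprn_ge0| |by rewrite ler_weXn2l // -ltnS prednK].
rewrite coef_map coef_zpoly ltn_ord /= -intr_norm [M%:R]pmulrn ler_int.
have := tsM i (ltn_ord i); lia.
Qed.

Lemma coef_prod_XsubC_le (c : nat) (rs : seq algC) i :
  (forall z, z \in rs -> `|z| <= c%:R) ->
  `|(\prod_(z <- rs) ('X - z%:P))`_i| <= (c.+1 ^ size rs)%:R.
Proof.
elim: rs i => [|z rs IHrs] i zc.
  by rewrite big_nil coef1; case: eqP => _; rewrite ?normr1 ?normr0.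
rewrite big_cons mulrBl coefB coefXM coefCM expnS natrM -addn1 natrD mulrDl mul1r.
have {}IHrs j : `|(\prod_(z <- rs) ('X - z%:P))`_j| <= (c.+1 ^ size rs)%:R.
  by apply: IHrs => y rsy; apply: zc; rewrite inE rsy orbT.
apply: le_trans (ler_normB _ _) _; rewrite addrC addn1; apply: lerD.
  by rewrite normrM ler_pM ?zc ?mem_head.
by case: eqP => // _; rewrite normr0 ler0n.
Qed.

(** This is (c+1)^d, where d is the degree and c = d M + 1 bounds the roots; compare [root_zpoly_le]
    and [coef_prod_XsubC_le]. *)
Definition conj_bound (ts : seq nat) M := ((size ts * M).+2 ^ size ts)%N.

(* A certificate that [y] is an algebraic integer and [z] a conjugate of it. *)
(* Any factor of the given polynomial has coefficients below [conj_bound].   *)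
Definition conj_cert (y z : algC) : Prop := exists ts M,
  [/\ bounded (fun=> M + M)%N ts, zhorner 1 ts M y = 0, zhorner 1 ts M z = 0 &
     forall us, (size us < size ts)%N -> bounded (fun=> conj_bound ts M + conj_bound ts M)%N us ->
       zhorner 1 us (conj_bound ts M) y <> 0].

Lemma conj_certP y z : y \in Aint -> root (minCpoly y) z -> conj_cert y z.
Proof.
move=> /Aint_minCpoly[p mp Dp]; have [ts [M [tsM Dts]]] := zpoly_monic_ex mp.
rewrite Dp Dts => /eqP zts; exists ts, M; split=> //.
  by apply/eqP; rewrite -[_ == 0]/(root _ _) -Dts -Dp root_minCpoly.
move=> us ltus _ /zhorner_dvd dvdy; have := dvdp_leq _ dvdy.
rewrite Dp Dts !size_zpolyC -size_poly_gt0 size_zpolyC => /(_ isT).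
by rewrite ltnS leqNgt ltus.
Qed.

(** Otherwise the minimal polynomial of y is a proper factor of the given one. It has integer
    coefficients, and its roots obey the bound for the given polynomial, so its coefficients are
    below [conj_bound]: it is one of the polynomials that the certificate excludes. *)
Lemma conj_cert_root y z : conj_cert y z -> root (minCpoly y) z.
Proof.
move=> [ts [M [tsM yts zts usN]]].
have dvdy := zhorner_dvd yts.
have mts : map_poly intr (zpoly 1 ts M) \is @monic algC by rewrite monic_map ?monic_zpoly.
suff -> : minCpoly y = map_poly intr (zpoly 1 ts M) by apply/eqP.
apply/eqP; rewrite -eqp_monic ?minCpoly_monic // -dvdp_size_eqp // size_zpolyC.
have [rs [_ Drs srs]] := minCpoly_roots y.
have := dvdp_leq (monic_neq0 mts) dvdy; rewrite size_zpolyC leq_eqVlt => /orP[//|ltd].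
have Ay : y \in Aint.
  apply: (root_monic_Aint (p := map_poly intr (zpoly 1 ts M))) => //; first exact/eqP.
  by apply/polyOverP => i; rewrite coef_map intr_int.
have [p mp Dp] := Aint_minCpoly Ay.
have szp : size p = (size rs).+1.
  by rewrite srs Dp size_map_inj_poly ?rmorph0 //; apply: intr_inj.
have [|||us [sus Bus pus]] := @zpoly_repr 1 p (size rs) (conj_bound ts M).
- move=> i _; rewrite -(ler_nat algC) natr_absz intr_norm -(coef_map (intr : int -> algC)) -Dp Drs.
  apply: le_trans (coef_prod_XsubC_le (c := (size ts * M).+1) _ _) _.
    move=> x rsx; apply: root_zpoly_le => //; apply/eqP; rewrite -[_ == 0]/(root _ _).
    by apply: root_dvdp dvdy _; rewrite Drs root_prod_XsubC.
  by rewrite ler_nat /conj_bound leq_pexp2l // -ltnS srs ltnW.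
- by have := monicP mp; rewrite lead_coefE szp.
- by rewrite szp.
case: (usN us) => //; first by rewrite sus -ltnS srs.
by apply/eqP; rewrite -[_ == 0]/(root _ _) -pus -Dp root_minCpoly.
Qed.

Lemma roots_zpoly ts M (rs : seq algC) z : uniq rs -> size rs = size ts ->
  (forall x, x \in rs -> zhorner 1 ts M x = 0) -> zhorner 1 ts M z = 0 -> z \in rs.
Proof.
move=> urs srs rsP zP; apply: contraT => nrsz.
suff : (size (z :: rs) < size (map_poly intr (zpoly 1 ts M) : {poly algC}))%N.
  by rewrite size_zpolyC /= srs ltnn.
apply: max_poly_roots; last by rewrite /= nrsz.
  by rewrite -size_poly_gt0 size_zpolyC.
by apply/allP => x; rewrite inE => /orP[/eqP->|/rsP/eqP //]; apply/eqP.
Qed.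

Lemma roots_zpoly_ex x : exists k ts M (rs : seq algC),
  [/\ (0 < k)%N, zhorner 1 ts M (k%:R * x) = 0, uniq rs, size rs = size ts &
    forall z, z \in rs -> zhorner 1 ts M (k%:R * z) = 0].
Proof.
have [k k0 Akx] := Aint_zmul x; have nzk : k%:R != 0 :> algC by rewrite pnatr_eq0 -lt0n.
have [p mp Dp] := Aint_minCpoly Akx; have [ts [M [_ Dts]]] := zpoly_monic_ex mp.
have [rs [urs Drs srs]] := minCpoly_roots (k%:R * x).
exists k, ts, M, [seq z / k%:R | z <- rs]; split=> //.
- by apply/eqP; rewrite -[_ == 0]/(root _ _) -Dts -Dp root_minCpoly.
- by rewrite map_inj_uniq //; apply: mulIf; rewrite invr_eq0.
- by rewrite size_map; apply: succn_inj; rewrite srs Dp Dts size_zpolyC.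
move=> _ /mapP[z rsz ->]; rewrite mulrCA divff // mulr1.
by apply/eqP; rewrite -[_ == 0]/(root _ _) -Dts -Dp Drs root_prod_XsubC.
Qed.

(** The same quotient of integer polynomials sends y to x and z to v; so an automorphism that sends
    y to z sends x to v. *)
Definition fraction_cert (x y v z : algC) : Prop := exists ts M us N,
  [/\ zhorner 0 us N y <> 0, x * zhorner 0 us N y = zhorner 0 ts M y &
     v * zhorner 0 us N z = zhorner 0 ts M z].

Lemma fraction_cert_aut x y (nu : {rmorphism algC -> algC}) v :
  fraction_cert x y v (nu y) -> v = nu x.
Proof.
move=> [ts [M [us [N [qN pq vE]]]]].
apply: (@mulIf _ (zhorner 0 us N (nu y))).
  by rewrite -zhorner_aut fmorph_eq0; apply/eqP.
by rewrite vE -!zhorner_aut -pq rmorphM.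
Qed.

Lemma fraction_certP x y (nu : {rmorphism algC -> algC}) :
  Qadj y x -> fraction_cert x y (nu x) (nu y).
Proof.
move=> [p [q Dx]].
suff [ts [M [us [N [qN pq]]]]] : exists ts M us N,
    zhorner 0 us N y <> 0 /\ x * zhorner 0 us N y = zhorner 0 ts M y.
  by exists ts, M, us, N; rewrite -!zhorner_aut -rmorphM pq.
have [q0|nzq] := eqVneq (map_poly ratr q).[y] 0.
  (* A zero denominator makes x equal to 0 by the convention on division, so the certificate is the
     quotient of the constants 0 and 1. *)
  exists [::], 0%N, [:: 1]%N, 0%N; rewrite !zhornerE Dx q0 invr0 mulr0 /= mul0r subr0 mulr0 addr0.
  by split=> //; apply/eqP; rewrite oner_eq0.
have [p' [a nza Dp]] := rat_poly_scale p; have [q' [b nzb Dq]] := rat_poly_scale q.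
have [ts [M Dts]] := zpoly_ex (b *: p'); have [us [N Dus]] := zpoly_ex (a *: q').
have aC : a%:~R != 0 :> algC by rewrite intr_eq0.
have bC : b%:~R != 0 :> algC by rewrite intr_eq0.
have hp : (map_poly ratr p).[y] = a%:~R^-1 * (map_poly intr p').[y].
  by rewrite Dp linearZ hornerZ /= pQtoC_int fmorphV rmorph_int.
have hq : (map_poly ratr q).[y] = b%:~R^-1 * (map_poly intr q').[y].
  by rewrite Dq linearZ hornerZ /= pQtoC_int fmorphV rmorph_int.
exists ts, M, us, N; rewrite /zhorner -Dts -Dus !map_polyZ !hornerZ /=.
have nzq' : (map_poly intr q').[y] != 0.
  by apply: contraNneq nzq => q'0; rewrite hq q'0 mulr0.
split; first by apply/eqP; rewrite mulf_neq0.
rewrite Dx hp hq; field; rewrite ?aC ?bC ?nzq' //.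
Qed.

End IntegerPolynomials.

(** * Automorphisms as functions on indices *)

Section Automorphisms.
Local Open Scope ring_scope.

Lemma autQ_rmorphism (f : autQ) : exists nu : {rmorphism algC -> algC}, nu =1 f.
Proof.
have [fB fM _] := autQP f.
pose fBM := GRing.isZmodMorphism.Build _ _ (autQ_fun f) fB.
pose fMM := GRing.isMonoidMorphism.Build _ _ (autQ_fun f) fM.
pose nu : {rmorphism algC -> algC} := HB.pack (autQ_fun f) fBM fMM.
by exists nu.
Qed.

Lemma rmorphism_autQ (nu : {rmorphism algC -> algC}) : exists f : autQ, f =1 nu.
Proof.
have nuA : is_automorphism nu.
  split; [exact: rmorphB | by split; [exact: rmorph1 | exact: rmorphM] |].
  by exists (algC_invaut nu); [exact: algC_autK | exact: algC_invautK].
by exists (AutQ nuA).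
Qed.

(** By normality r lies in Q(z), so z |-> r defines an endomorphism of that number field, and this
    extends to the algebraic closure. *)
Lemma autQ_of_root z r : normalQ (Qadj z) -> root (minCpoly z) r ->
  exists f : autQ, f z = r.
Proof.
move=> normz zr.
have [|p [q Dr]] := normz z r _ zr.
  by exists 'X, 1; rewrite map_polyX rmorph1 hornerX hornerC divr1.
have [Qn [QnC [[|zn []] // [Dz]]] genQn] := num_field_exists [:: z].
have QnCh t : QnC (map_poly (in_alg Qn) t).[zn] = (map_poly ratr t).[z].
  rewrite -horner_map Dz -map_poly_comp; congr (_.[_]); apply: eq_map_poly => a /=.
  by rewrite alg_num_field fmorph_rat.
pose rn := (map_poly (in_alg Qn) p).[zn] / (map_poly (in_alg Qn) q).[zn].
have Drn : QnC rn = r by rewrite /rn fmorph_div !QnCh.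
pose phi := kHomExtend 1 \1 zn rn.
have homQn1 : kHom 1 1 (\1%VF : 'End(Qn)) by rewrite kHom1.
have /polyOver1P[m Dm] := minPolyOver 1 zn.
have rootm x : root (map_poly QnC (minPoly 1 zn)) x = root (map_poly ratr m) x.
  rewrite Dm -map_poly_comp; congr (root _ x); apply: eq_map_poly => a /=.
  by rewrite alg_num_field fmorph_rat.
have pzn_rn : root (map_poly \1%VF (minPoly 1 zn)) rn.
  rewrite lfun1_poly -(fmorph_root QnC) Drn rootm.
  have : root (map_poly ratr m) z by rewrite -rootm -Dz fmorph_root root_minPoly.
  have [m' [Dm' _ ->]] := minCpolyP z => /dvdpP[t ->].
  by rewrite rmorphM rootM /= -Dm' zr orbT.
have phim : monoid_morphism phi.
  by apply/kHom_monoid_morphism; rewrite -genQn span_seq1 /= kHomExtendP.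
pose phimM := GRing.isMonoidMorphism.Build _ _ phi phim.
pose phiRM : {rmorphism _ -> _} := HB.pack (fun_of_lfun phi) phimM.
have [nu Dnu] := extend_algC_subfield_aut QnC phiRM.
have [f fnu] := rmorphism_autQ nu; exists f; rewrite fnu -Dz -Dnu /=.
by rewrite (kHomExtend_val homQn1 pzn_rn).
Qed.

End Automorphisms.

(** Turns a search over lists of given length with bounded entries into a search over numbers below
    the code of the list of bounds. *)
Lemma enc_le (s t : seq nat) : size s <= size t ->
  (forall i, i < size s -> nth 0 s i <= nth 0 t i) -> enc s <= enc t.
Proof.
elim: s t => [|x s IHs] [|y t] // lest lenth; rewrite !enc_cons !npairS.
apply: leq_mul; first by rewrite leq_exp2l //; apply: (lenth 0).
by rewrite ltnS leq_double; apply: IHs => // i; apply: (lenth i.+1).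
Qed.

Lemma eff_exp (J : set (nat -> nat)) (JP : turing_ideal J) A (eA : encoding A) (f g : A -> nat) :
  eff J f -> eff J g -> eff J (fun a => f a ^ g a).
Proof.
move=> fP gP; apply: eq_eff (eff_natrec JP (h := fun a _ r => f a * r) gP (eff_const JP 1) _).
  by move=> a; elim: (g a) => [|k /= ->]; rewrite ?expn0 ?expnS.
by eff_tac; apply: (eff_comp JP fP); eff_tac.
Qed.

(** * Arithmetic on indices and enumerable certificates *)

Section Presentation.
Variables (Q : presentation) (F : tower Q).
Local Notation elt := (elt Q).
Local Notation idx := (idx Q).
Let eltK := eltK Q.
Let idxK := idxK Q.

Definition addI i j := idx (elt i + elt j)%R.
Definition mulI i j := idx (elt i * elt j)%R.
Definition natI n := idx n%:R%R.
Definition hornerI b ts M x :=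
  foldr (fun t a => addI (addI (natI t) (mulI (idx (-1)%R) (natI M))) (mulI x a)) (natI b) ts.

Lemma elt_natI n : elt (natI n) = n%:R%R. Proof. exact: idxK. Qed.

Lemma elt_addI i j : elt (addI i j) = (elt i + elt j)%R. Proof. exact: idxK. Qed.

Lemma elt_mulI i j : elt (mulI i j) = (elt i * elt j)%R. Proof. exact: idxK. Qed.

Lemma elt_hornerI b ts M x : elt (hornerI b ts M x) = zhorner b ts M (elt x).
Proof.
rewrite zhornerE; elim: ts => [|t ts IHts] /=; first exact: idxK.
by rewrite !(elt_addI, elt_mulI, elt_natI) idxK IHts mulN1r.
Qed.

Lemma elt_inj : injective elt. Proof. exact: can_inj eltK. Qed.

Definition conjI y z := exists ts M, bounded (fun=> M + M) ts /\
  hornerI 1 ts M y = natI 0 /\ hornerI 1 ts M z = natI 0 /\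
  forall c, c < (enc (mkseq (fun=> conj_bound ts M + conj_bound ts M) (size ts))).+1 ->
    size ts <= size (CodeSeq.decode c) \/
    (~~ bounded (fun=> conj_bound ts M + conj_bound ts M) (CodeSeq.decode c) \/
     hornerI 1 (CodeSeq.decode c) (conj_bound ts M) y <> natI 0).

Lemma hornerI0 b ts M x : hornerI b ts M x = natI 0 <-> zhorner b ts M (elt x) = 0%R.
Proof.
by rewrite -elt_hornerI; split=> [->|]; [rewrite elt_natI | move=> h; apply: elt_inj; rewrite elt_natI].
Qed.

Lemma conjIP y z : conjI y z <-> conj_cert (elt y) (elt z).
Proof.
split=> [[ts [M [tsM [/hornerI0 yts [/hornerI0 zts usN]]]]]|[ts [M [tsM yts zts usN]]]].
  exists ts, M; split=> // us ltus usM /hornerI0; have := usN (@enc _ (enc_seq enc_nat) us).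
  rewrite decode_enc usM (leqNgt (size ts)) ltus => usN'.
  have {usN'}[|//|[]//] := usN' _.
  rewrite ltnS; apply: enc_le => [|i lti]; first by rewrite size_mkseq ltnW.
  by rewrite nth_mkseq ?(ltn_trans lti) //; apply: (boundedP _ _ usM).
exists ts, M; split=> //; split; first exact/hornerI0; split; first exact/hornerI0.
move=> c _; have [|ltc] := leqP; [by left | right].
by case: (boolP (bounded _ _)) => [Bc|]; [right => /hornerI0; apply: usN | left].
Qed.

Definition fractionI x y v z := exists ts M us N,
  hornerI 0 us N y <> natI 0 /\
  (mulI x (hornerI 0 us N y) = hornerI 0 ts M y /\
   mulI v (hornerI 0 us N z) = hornerI 0 ts M z).

Lemma fractionIP x y v z :
  fractionI x y v z <-> fraction_cert (elt x) (elt y) (elt v) (elt z).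
Proof.
have E w b ts M us N t : mulI w (hornerI b us N t) = hornerI b ts M t <->
    (elt w * zhorner b us N (elt t) = zhorner b ts M (elt t))%R.
  by rewrite -!elt_hornerI -elt_mulI; split=> [->|/elt_inj].
split=> [] [ts [M [us [N]]]].
  case=> qN [/E xy /E vz]; exists ts, M, us, N; split=> // q0; apply: qN; exact/hornerI0.
case=> qN xy vz; exists ts, M, us, N; split; last by split; apply/E.
by move=> /hornerI0.
Qed.

Definition index_map (f : autQ) (i : nat) : nat := idx (f (elt i)).

Lemma elt_full f i : elt (index_map f i) = f (elt i). Proof. exact: idxK. Qed.

(** The string is read as a finite map on indices. The witnesses are a normal field of the tower, an
    image [r] for its generator, and a factor [k] that makes the generator an algebraic integer, as
    conjugacy certificates require. *)
Definition extendible s := exists m r k, 0 < k /\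
  (conjI (mulI (natI k) (gen F m)) (mulI (natI k) r) /\
   forall i, i < size s -> fractionI i (gen F m) (nth 0 s i) r).

Lemma minCpoly_scale k z r : 0 < k -> root (minCpoly (k%:R * z)%R) (k%:R * r)%R ->
  root (minCpoly z) r.
Proof.
move=> k0; have [p [Dp mp pP]] := minCpolyP z.
pose q := (p \Po (k%:R^-1 *: 'X))%R : {poly rat}.
have qE (x : algC) : root (map_poly ratr q) (k%:R * x)%R = root (map_poly ratr p) x.
  rewrite /q !rootE map_comp_poly horner_comp linearZ /= map_polyX hornerZ hornerX.
  by rewrite fmorphV rmorph_nat mulKf // pnatr_eq0 -lt0n.
have [t [Dt mt tP]] := minCpolyP (k%:R * z)%R.
have : root (map_poly ratr q) (k%:R * z)%R by rewrite qE -Dp root_minCpoly.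
by rewrite tP Dp -qE => /dvdpP[u ->]; rewrite rmorphM rootM /= -Dt => ->; rewrite orbT.
Qed.

Lemma tower_le m n : m <= n -> tower_field F m `<=` tower_field F n.
Proof.
move=> /subnK <-; elim: (n - m) => // k IHk.
by apply: subset_trans IHk _; apply: tower_sub.
Qed.

Lemma tower_ex n : exists m, forall i, i < n -> tower_field F m (elt i).
Proof.
elim: n => [|n [m mP]]; first by exists 0.
have [k _ kn] : (\bigcup_k tower_field F k) (elt n) by rewrite tower_cover.
exists (maxn k m) => i; rewrite ltnS leq_eqVlt => /orP[/eqP->|/mP].
  exact: tower_le (leq_maxl _ _) _ kn.
exact: tower_le (leq_maxr _ _) _.
Qed.

Lemma extendibleP s : extendible s <-> exists f, s = mkseq (index_map f) (size s).
Proof.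
split=> [[m [r [k [k0 [/conjIP/conj_cert_root + frac]]]]]|[f Ds]].
  rewrite !elt_mulI !elt_natI => /(minCpoly_scale k0) zr.
  have [f fz] := autQ_of_root (@tower_normal _ F m) zr.
  have [nu nuf] := autQ_rmorphism f.
  exists f; apply: (@eq_from_nth _ 0); rewrite ?size_mkseq // => i lti.
  rewrite nth_mkseq //; apply: elt_inj; rewrite elt_full -nuf.
  by have /fractionIP := frac i lti; rewrite -fz -nuf => /fraction_cert_aut.
have [nu nuf] := autQ_rmorphism f.
have [m mP] := tower_ex (size s); pose z := elt (gen F m).
have [k k0 Ak] := Aint_zmul z.
exists m, (index_map f (gen F m)), k; split=> //; split.
  apply/conjIP; rewrite !elt_mulI !elt_natI elt_full -nuf.
  apply: (conj_certP Ak); have := root_minCpoly (nu (k%:R * z)%R).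
  by rewrite minCpoly_aut rmorphM rmorph_nat.
move=> i lti; apply/fractionIP; rewrite Ds nth_mkseq // !elt_full -!nuf.
by apply: fraction_certP; apply: mP.
Qed.

Section Computability.
Variables (J : set (nat -> nat)) (JP : turing_ideal J).

Section Domain.
Context {A : Type} {eA : encoding A}.
Implicit Types f g : A -> nat.

Lemma eff_addI f g : eff J f -> eff J g -> eff J (fun a => addI (f a) (g a)).
Proof.
move=> fP gP; apply: (@eff_comp2 J JP _ _ _ _ _ _ _ _ addI) => //.
exists (fun x => addI (nfst x) (nsnd x)); last by move=> [i j]; rewrite enc_pair nfstK nsndK.
exact: ideal_computable2 (add_computable Q).
Qed.

Lemma eff_mulI f g : eff J f -> eff J g -> eff J (fun a => mulI (f a) (g a)).
Proof.
move=> fP gP; apply: (@eff_comp2 J JP _ _ _ _ _ _ _ _ mulI) => //.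
exists (fun x => mulI (nfst x) (nsnd x)); last by move=> [i j]; rewrite enc_pair nfstK nsndK.
exact: ideal_computable2 (mul_computable Q).
Qed.

Lemma eff_gen f : eff J f -> eff J (fun a => gen F (f a)).
Proof.
by apply: (eff_comp JP); apply: (ideal_eff _ _).1; apply: ideal_computable1 (gen_computable F).
Qed.

End Domain.

Lemma eff_natI A (eA : encoding A) (f : A -> nat) : eff J f -> eff J (fun a => natI (f a)).
Proof.
move=> fP; apply: eq_eff (eff_natrec JP (h := fun _ _ r => addI r (natI 1)) fP (eff_const JP (natI 0)) _).
  move=> a; elim: (f a) => //= k ->; apply: elt_inj.
  by rewrite elt_addI !elt_natI -natrD addn1.
by apply: eff_addI; eff_tac.
Qed.

Lemma eff_hornerI A (eA : encoding A) (b M x : A -> nat) ts :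
  eff J b -> eff J ts -> eff J M -> eff J x -> eff J (fun a => hornerI (b a) (ts a) (M a) (x a)).
Proof.
move=> bP tsP MP xP; rewrite /hornerI; eff_tac; last exact: eff_natI.
apply: eff_addI; [apply: eff_addI|apply: eff_mulI]; eff_tac; first by apply: eff_natI; eff_tac.
  by apply: eff_mulI; eff_tac; apply: eff_natI; apply: (eff_comp JP MP); eff_tac.
by apply: (eff_comp JP xP); eff_tac.
Qed.

End Computability.

End Presentation.

Ltac eff_user ::= lazymatch goal with
 | |- eff _ (fun a => expn (@?f a) (@?g a)) => apply: eff_exp
 | |- eff _ (fun a => addI _ (@?f a) (@?g a)) => apply: eff_addI
 | |- eff _ (fun a => mulI _ (@?f a) (@?g a)) => apply: eff_mulI
 | |- eff _ (fun a => gen _ (@?f a)) => apply: eff_gen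
 | |- eff _ (fun a => natI _ (@?f a)) => apply: eff_natI
 | |- eff _ (fun a => hornerI _ (@?b a) (@?ts a) (@?M a) (@?x a)) => apply: eff_hornerI
 end.

Section Enumerability.
Variables (Q : presentation) (F : tower Q) (J : set (nat -> nat)) (JP : turing_ideal J).
Context {A : Type} {eA : encoding A}.

Lemma re_conjI (f g : A -> nat) : eff J f -> eff J g -> re J (fun a => conjI Q (f a) (g a)).
Proof.
move=> fP gP; apply: (@re_comp _ JP _ _ _ _ (fun p : nat * nat => conjI Q p.1 p.2) (fun a => (f a, g a))).
  by rewrite /conjI /conj_bound /bounded; re_tac.
by eff_tac.
Qed.

Lemma re_fractionI (x y v z : A -> nat) :
  eff J x -> eff J y -> eff J v -> eff J z -> re J (fun a => fractionI Q (x a) (y a) (v a) (z a)).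
Proof.
move=> xP yP vP zP.
apply: (@re_comp _ JP _ _ _ _ (fun p : (nat * nat) * (nat * nat) => fractionI Q p.1.1 p.1.2 p.2.1 p.2.2)
  (fun a => ((x a, y a), (v a, z a)))).
  by rewrite /fractionI; re_tac.
by eff_tac.
Qed.

End Enumerability.

Lemma re_extendible Q F (J : set (nat -> nat)) (JP : turing_ideal J) A (eA : encoding A) s :
  eff J s -> re J (fun a : A => @extendible Q F (s a)).
Proof.
move=> sP; apply: (@re_comp _ JP _ _ _ _ (@extendible Q F) s _ sP).
rewrite /extendible; re_tac.
  by apply: re_conjI => //; eff_tac.
by apply: re_fractionI => //; eff_tac.
Qed.

(** * Codes of automorphisms as a computably bounded closed class *)

Section Automorphism.
Variables (Q : presentation) (F : tower Q).
Local Notation elt := (elt Q).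
Local Notation idx := (idx Q).
Local Notation full := (index_map Q).

(** An automorphism permutes the roots of a rational polynomial. The search finds a polynomial that
    vanishes at k times element i, together with as many distinct roots as its degree; these are
    then all the roots, and [b] bounds their indices. *)
Lemma full_bound (J : set (nat -> nat)) : turing_ideal J ->
  exists2 B, J B & forall f i, full f i <= B i.
Proof.
move=> JP; pose P i b := exists k ts M rs, 0 < k /\ (hornerI Q 1 ts M (mulI Q (natI Q k) i) = natI Q 0 /\
  (size rs = size ts /\ forall j, j < size rs ->
    hornerI Q 1 ts M (mulI Q (natI Q k) (nth 0 rs j)) = natI Q 0 /\ (nth 0 rs j <= b /\
    forall l, l < j -> nth 0 rs l <> nth 0 rs j))).
have [||B JB PB] := @ideal_uniformize J JP P; first by rewrite /P; re_tac.
  move=> i; have [k [ts [M [rs [k0 ix urs srs rsP]]]]] := roots_zpoly_ex (elt i).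
  exists (\max_(j < size rs) idx (nth 0%R rs j)), k, ts, M, (map idx rs); split=> //; split.
    by apply/hornerI0; rewrite elt_mulI elt_natI.
  split; first by rewrite size_map.
  move=> j; rewrite size_map => ltj; split; last split.
  - by apply/hornerI0; rewrite elt_mulI elt_natI (nth_map 0%R) // idxK; apply/rsP/mem_nth.
  - rewrite (nth_map 0%R) //.
    exact: (leq_bigmax (F := fun j : 'I_(size rs) => idx (nth 0%R rs j)) (Ordinal ltj)).
  - move=> l ltl; have lts := ltn_trans ltl ltj; rewrite !(nth_map 0%R) //.
    by move=> /(can_inj (idxK Q))/eqP; rewrite nth_uniq // (ltn_eqF ltl).
exists B => // f i; have [k [ts [M [rs [k0 [/hornerI0 ix [srs rsP]]]]]]] := PB i.
rewrite elt_mulI elt_natI in ix.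
have k0C : (k%:R != 0 :> algC)%R by rewrite pnatr_eq0 -lt0n.
have [nu nuf] := autQ_rmorphism f.
have : (k%:R * f (elt i))%R \in [seq (k%:R * elt r)%R | r <- rs].
  apply: (@roots_zpoly ts M).
  - rewrite map_inj_uniq => [|x y /(mulfI k0C)/elt_inj //].
    apply/(uniqP 0) => l j; rewrite !inE => ltl ltj eqlj.
    by case: (ltngtP l j) => // ltlj; [case: (rsP j ltj) | case: (rsP l ltl)] => _ [_ /(_ _ ltlj)];
      rewrite eqlj.
  - by rewrite size_map.
  - move=> _ /mapP[r /(nthP 0)[j ltj <-] ->].
    by have [/hornerI0] := rsP j ltj; rewrite elt_mulI elt_natI.
  - by rewrite -nuf -(rmorph_nat nu k) -rmorphM -zhorner_aut ix rmorph0.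
move=> /mapP[r /(nthP 0)[j ltj <-] /(mulfI k0C) fr].
by have [_ [+ _]] := rsP j ltj; rewrite (_ : full f i = nth 0 rs j) // /index_map fr eltK.
Qed.

(** To compute f at i, search for a generator z in terms of which i is a quotient of polynomials;
    the image of z then determines f at i. *)
Lemma full_ideal (J : set (nat -> nat)) (f : autQ) : turing_ideal J ->
  J (fun n => idx (f (elt (gen F n.+1)))) <-> J (full f).
Proof.
move=> JP; split=> [Jf|Jf]; last first.
  by apply/ideal_eff; apply: (eff_comp JP (g := fun n => gen F n.+1) ((ideal_eff _ _).1 Jf)); eff_tac.
have [nu nuf] := autQ_rmorphism f.
apply: (ideal_graph JP).
apply: (@re_iff _ _ _ (fun p : nat * nat => exists m,
    fractionI Q p.1 (gen F m.+1) p.2 (full f (gen F m.+1)))).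
  move=> [i v] /=; split=> [[m /fractionIP]|<-].
    by rewrite elt_full -nuf => /fraction_cert_aut vE; apply: (@elt_inj Q); rewrite elt_full -nuf.
  have [m _ mi] : (\bigcup_k tower_field F k) (elt i) by rewrite tower_cover.
  exists m; apply/fractionIP; rewrite !elt_full -!nuf; apply: fraction_certP.
  (* The sequence that codes f starts with the generator of index 1, hence the move to the next
     field. *)
  exact: tower_sub mi.
re_tac; apply: re_fractionI => //; eff_tac.
by apply: (eff_comp JP (g := @snd (nat * nat) nat) ((ideal_eff _ _).1 Jf)); eff_tac.
Qed.

Definition violates (s : seq nat) : Prop :=
  (natI Q 1 < size s /\ nth 0 s (natI Q 1) <> natI Q 1) \/
  exists i j, i < size s /\ (j < size s /\
    ((addI Q i j < size s /\ nth 0 s (addI Q i j) <> addI Q (nth 0 s i) (nth 0 s j)) \/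
     (mulI Q i j < size s /\ nth 0 s (mulI Q i j) <> mulI Q (nth 0 s i) (nth 0 s j)))).

Lemma re_violates (J : set (nat -> nat)) (JP : turing_ideal J) A (eA : encoding A) s :
  eff J s -> re J (fun a : A => violates (s a)).
Proof.
move=> sP; apply: (@re_comp _ JP _ _ _ _ violates s _ sP).
by rewrite /violates; re_tac.
Qed.

Lemma violates_prefix s t : violates s -> violates (s ++ t).
Proof.
have lt i : i < size s -> i < size (s ++ t) by rewrite size_cat => /ltn_addr.
have nthE i : i < size s -> nth 0 (s ++ t) i = nth 0 s i by rewrite nth_cat => ->.
case=> [[l1 n1]|[i [j [li [lj [[lk nk]|[lk nk]]]]]]].
- by left; rewrite nthE //; split; auto.
- by right; exists i, j; rewrite (nthE i) // (nthE j) // (nthE _ lk); do 2!(split; first exact: lt); left; split; auto.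
- by right; exists i, j; rewrite (nthE i) // (nthE j) // (nthE _ lk); do 2!(split; first exact: lt); right; split; auto.
Qed.

Lemma full_violates f n : ~ violates (mkseq (full f) n).
Proof.
have [nu nuf] := autQ_rmorphism f.
case=> [[]|[i [j []]]]; rewrite !size_mkseq.
  by move=> lt1; rewrite nth_mkseq //; apply; apply: (@elt_inj Q); rewrite elt_full !elt_natI -nuf rmorph1.
move=> li [lj [] [] lk]; rewrite !nth_mkseq //; apply; apply: (@elt_inj Q).
  by rewrite elt_full !elt_addI !elt_full -!nuf rmorphD.
by rewrite elt_full !elt_mulI !elt_full -!nuf rmorphM.
Qed.

(** Bijectivity needs no test: a ring endomorphism of the algebraic closure is an automorphism. *)
Lemma full_ex p : (forall n, ~ violates (mkseq p n)) -> exists f, full f = p.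
Proof.
move=> pN.
have pone : p (natI Q 1) = natI Q 1.
  apply: contrapT => pone; apply: (pN (natI Q 1).+1); left.
  by rewrite size_mkseq nth_mkseq.
have padd i j : p (addI Q i j) = addI Q (p i) (p j).
  apply: contrapT => pij; apply: (pN (maxn (maxn i j) (addI Q i j)).+1); right; exists i, j.
  set N := (maxn _ _).+1; have [li lj lk] : [/\ i < N, j < N & addI Q i j < N].
    by split; rewrite ltnS !leq_max leqnn ?orbT.
  rewrite !size_mkseq; do 2!(split=> //); left; split=> //.
  by rewrite !nth_mkseq.
have pmul i j : p (mulI Q i j) = mulI Q (p i) (p j).
  apply: contrapT => pij; apply: (pN (maxn (maxn i j) (mulI Q i j)).+1); right; exists i, j.
  set N := (maxn _ _).+1; have [li lj lk] : [/\ i < N, j < N & mulI Q i j < N].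
    by split; rewrite ltnS !leq_max leqnn ?orbT.
  rewrite !size_mkseq; do 2!(split=> //); right; split=> //.
  by rewrite !nth_mkseq.
pose g x := elt (p (idx x)).
have gD x y : g (x + y)%R = (g x + g y)%R.
  by rewrite /g -[in LHS](idxK Q x) -[in LHS](idxK Q y) padd elt_addI.
have gM : GRing.monoid_morphism g.
  split=> [|x y]; first by rewrite /g -[1%R]/(1%:R)%R pone elt_natI.
  by rewrite /g -[in LHS](idxK Q x) -[in LHS](idxK Q y) pmul elt_mulI.
have gB : zmod_morphism g.
  by move=> x y; apply/eqP; rewrite eq_sym subr_eq -gD subrK.
pose nu : {rmorphism algC -> algC} := HB.pack g (GRing.isZmodMorphism.Build _ _ g gB)
  (GRing.isMonoidMorphism.Build _ _ g gM).
have [f fnu] := rmorphism_autQ nu; exists f; apply/funext => i; apply: (@elt_inj Q).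
by rewrite elt_full fnu /= /g eltK.
Qed.

Lemma co_re_aut (J : set (nat -> nat)) (JP : path_ideal J) B (R : seq nat -> Prop) :
  J B -> re J (fun s => ~ R s) -> (forall s t, R (s ++ t) -> R s) ->
  (forall n, exists s, [/\ size s = n, bounded B s, ~ violates s & R s]) ->
  exists2 f, J (full f) & forall n, R (mkseq (full f) n).
Proof.
move=> JB RP Rcat Rn; have JP' : turing_ideal J := JP.
have [||n|p [Jp pR pB]] := @co_re_path J JP B JB (fun s => ~ (violates s \/ ~ R s)).
- apply: (@re_iff _ _ _ (fun s => violates s \/ ~ R s)); first by move=> s; split; [auto|move/contrapT].
  by re_tac; apply: re_violates => //; eff_tac.
- move=> s t nst; case=> [vs|nRs]; apply: nst; [left|right].
    exact: violates_prefix.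
  by move=> Rst; apply: nRs; apply: Rcat Rst.
- by have [s [sn Bs vs Rs]] := Rn n; exists s; split=> // -[].
have [n vn|f fp] := @full_ex p; first by apply: (pR n); left.
exists f; rewrite fp // => n; apply: contrapT => nR; apply: (pR n).
by right.
Qed.

End Automorphism.

(** * Positive formulas *)

Section Logic.
Variables (Q : presentation) (F : tower Q).
Local Notation full := (index_map Q).
Local Notation prefixes := (seq (seq nat)).

Definition AutJ (J : set (nat -> nat)) : set autQ := [set f | J (full f)].

Definition pre n (e : seq autQ) : prefixes := [seq mkseq (full f) n | f <- e].

Definition env_le (s t : prefixes) : Prop :=
  size s = size t /\ forall j, prefix (nth [::] s j) (nth [::] t j).

Definition monotone (U : prefixes -> Prop) : Prop :=
  forall s t, env_le s t -> U s -> U t.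

Lemma mkseq_prefix (p : nat -> nat) m n : m <= n -> prefix (mkseq p m) (mkseq p n).
Proof. by move=> /subnKC <-; rewrite /mkseq iotaD map_cat prefix_prefix. Qed.

Lemma nth_pre n e j :
  nth [::] (pre n e) j = if j < size e then mkseq (full (nth autQ_one e j)) n else [::].
Proof.
case: ltnP => ltj; first by rewrite (nth_map autQ_one).
by rewrite nth_default // size_map.
Qed.

Lemma pre_le m n e : m <= n -> env_le (pre m e) (pre n e).
Proof.
move=> lemn; split=> [|j]; first by rewrite !size_map.
by rewrite !nth_pre; case: ifP => // _; apply: mkseq_prefix.
Qed.

Lemma env_le_cons s t u v : prefix u v -> env_le s t -> env_le (u :: s) (v :: t).
Proof. by move=> uv [st stP]; split=> [|[|j]] //=; rewrite st. Qed.

Lemma nth_prefix (s t : seq nat) i : prefix s t -> i < size s ->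
  i < size t /\ nth 0 t i = nth 0 s i.
Proof. by move=> /prefixP[u ->] lti; rewrite size_cat nth_cat lti ltn_addr. Qed.

Lemma eff_pre (J : set (nat -> nat)) (JP : turing_ideal J) e :
  (forall f, f \in e -> J (full f)) -> eff J (fun n => pre n e).
Proof.
elim: e => [|f e IHe] eJ /=; first exact: (eff_const JP).
apply: (eff_cons JP); last by apply: IHe => g eg; apply: eJ; rewrite inE eg orbT.
have /ideal_eff fJ : J (full f) by apply: eJ; rewrite mem_head.
by eff_tac; apply: (eff_comp JP fJ); eff_tac.
Qed.

Section Enumeration.
Variables (J0 : set (nat -> nat)) (J0P : turing_ideal J0) (B : nat -> nat) (JB : J0 B).
Hypothesis fullB : forall f i, full f i <= B i.

(** Compactness in finite form: at some level every bounded string not yet excluded as an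
    automorphism is refuted. By [enc_le] the quantifier over strings is bounded, so enumerability is
    preserved. *)
Definition ex_refute (U : prefixes -> Prop) (s : prefixes) : Prop :=
  exists n, forall c, c < (enc (mkseq B n)).+1 ->
    size (CodeSeq.decode c) <> n \/ (~~ bounded B (CodeSeq.decode c) \/
      (violates Q (CodeSeq.decode c) \/ U (CodeSeq.decode c :: s))).

Definition all_refute (U : prefixes -> Prop) (s : prefixes) : Prop :=
  exists t, extendible F t /\ U (t :: s).

Lemma ex_refuteP U s : ex_refute U s <-> exists n, forall t,
  size t = n -> bounded B t -> ~ violates Q t -> U (t :: s).
Proof.
split=> [] [n nU]; exists n.
  move=> t tn Bt vt; have := nU (@enc _ (enc_seq enc_nat) t); rewrite decode_enc Bt => tU.
  have {tU}[|//|[//|[//|//]]] := tU _.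
  rewrite ltnS; apply: enc_le => [|i lti]; first by rewrite size_mkseq tn.
  by rewrite nth_mkseq -?tn //; apply: (boundedP _ _ Bt).
move=> c _; have [tn|] := pselect (size (CodeSeq.decode c) = n); [right | by left].
case: (boolP (bounded _ _)) => [Bt|]; [right | by left].
by have [|vt] := pselect (violates Q (CodeSeq.decode c)); [left | right; apply: nU].
Qed.

Lemma re_ex_refute U : re J0 U -> re J0 (ex_refute U).
Proof.
move=> UP; have JBP := (ideal_eff _ _).1 JB.
rewrite /ex_refute; re_tac; first by apply: (eff_comp J0P JBP); eff_tac.
- by apply: eff_bounded => //; eff_tac.
- by apply: re_violates => //; eff_tac.
- apply: (@re_comp _ J0P _ _ _ _ U (fun p : prefixes * nat * nat => CodeSeq.decode p.2 :: p.1.1)) => //.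
  by eff_tac.
Qed.

Lemma re_all_refute U : re J0 U -> re J0 (all_refute U).
Proof.
move=> UP; rewrite /all_refute; re_tac; first by apply: re_extendible => //; eff_tac.
apply: (@re_comp _ J0P _ _ _ _ U (fun p : prefixes * seq nat => p.2 :: p.1)) => //.
by eff_tac.
Qed.

Lemma monotone_ex_refute U : monotone U -> monotone (ex_refute U).
Proof.
move=> Umono s t st /ex_refuteP[n nU]; apply/ex_refuteP; exists n => u un Bu vu.
by apply: (Umono (u :: s)); [apply: env_le_cons; rewrite ?prefix_refl | apply: nU].
Qed.

Lemma monotone_all_refute U : monotone U -> monotone (all_refute U).
Proof.
move=> Umono s t st [u [ext_u Us]]; exists u; split=> //.
by apply: (Umono (u :: s)) => //; apply: env_le_cons; rewrite ?prefix_refl.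
Qed.

Section Paths.
Variables (J : set (nat -> nat)) (JP : path_ideal J).
Hypothesis sJ0J : J0 `<=` J.

Let JP' : turing_ideal J := JP.

(** The right-hand side does not depend on [J]. If it holds, every level of the tree of unrefuted
    strings is inhabited, and [co_re_aut] finds a witness in [J]. *)
Lemma ex_refute_correct U e : re J0 U -> monotone U -> (forall f, f \in e -> AutJ J f) ->
  (exists2 f, AutJ J f & forall n, ~ U (pre n (f :: e))) <->
  forall n, ~ ex_refute U (pre n e).
Proof.
move=> UP Umono eJ; split=> [[f _ fU] m /ex_refuteP[n nU]|eN].
  apply: (fU (maxn m n)); apply: (Umono (mkseq (full f) n :: pre m e)).
    by apply: env_le_cons; [apply: mkseq_prefix; apply: leq_maxr | apply: pre_le; apply: leq_maxl].
  apply: nU; [exact: size_mkseq | | exact: full_violates].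
  by apply/boundedP => i; rewrite size_mkseq => lti; rewrite nth_mkseq.
have eP : eff J (fun n => pre n e) by apply: eff_pre.
have UJ : re J U by apply: re_sub_ideal UP.
(* The restrictions of [e] are cut at the length of the node, so one tree treats all of them. *)
have [||||f Jf fR] := @co_re_aut Q J JP B (fun s => ~ U (s :: pre (size s) e)).
- exact: sJ0J.
- apply: (@re_iff _ _ _ (fun s => U (s :: pre (size s) e))); first by move=> s; split; [auto|move/contrapT].
  apply: (@re_comp _ JP' _ _ _ _ U (fun s => s :: pre (size s) e)) => //.
  by eff_tac; apply: (eff_comp JP' eP); eff_tac.
- move=> s t stN Us; apply: stN; apply: (Umono (s :: pre (size s) e)) => //.
  by apply: env_le_cons; [apply: prefix_prefix | apply: pre_le; rewrite size_cat leq_addr].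
- move=> n; apply: contrapT => nN; apply: (eN n); apply/ex_refuteP; exists n => t tn Bt vt.
  by apply: contrapT => Ut; apply: nN; exists t; split=> //; rewrite tn.
by exists f => // n; have := fR n; rewrite size_mkseq.
Qed.

(** Here f need not be in [J]: agreement with it below n is a finite condition, and f itself shows
    that the tree is infinite. *)
Lemma autJ_dense f n : exists2 g, AutJ J g & mkseq (full g) n = mkseq (full f) n.
Proof.
pose R (s : seq nat) := forall i, i < minn (size s) n -> nth 0 s i = full f i.
have [||||g Jg gR] := @co_re_aut Q J JP B R.
- exact: sJ0J.
- apply: (@re_iff _ _ _ (fun s => exists i, (i < size s /\ i < n) /\
      nth 0 s i <> nth 0 (mkseq (full f) n) i)); last by re_tac.
  move=> s; split=> [[i [[lis lin]]]|sR].
    by rewrite nth_mkseq // => sN Rs; apply/sN/Rs; rewrite leq_min lis.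
  apply: contrapT => sN; apply: sR => i; rewrite leq_min => /andP[lis lin].
  by apply: contrapT => si; apply: sN; exists i; rewrite nth_mkseq.
- move=> s t stR i; rewrite leq_min => /andP[lis lin].
  by have := stR i; rewrite leq_min size_cat ltn_addr // lin nth_cat lis => ->.
- move=> m; exists (mkseq (full f) m); split; [exact: size_mkseq | | exact: full_violates |].
    by apply/boundedP => i; rewrite size_mkseq => lti; rewrite nth_mkseq.
  by move=> i; rewrite size_mkseq leq_min => /andP[lim _]; rewrite nth_mkseq.
exists g => //; apply: (@eq_from_nth _ 0); rewrite ?size_mkseq // => i lin.
by rewrite gR ?size_mkseq ?minnn // nth_mkseq.
Qed.

(** A refuting string extends to some automorphism, and by density to one in [J]. *)
Lemma all_refute_correct U e : monotone U ->
  (forall f, AutJ J f -> forall n, ~ U (pre n (f :: e))) <->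
  forall n, ~ all_refute U (pre n e).
Proof.
move=> Umono; split=> [eU n [s [/extendibleP[f sE] Us]]|eN f Jf n Ufe].
  have [g Jg gf] := autJ_dense f (size s).
  apply: (eU g Jg (maxn (size s) n)); apply: Umono Us.
  apply: env_le_cons; last by apply: pre_le; apply: leq_maxr.
  by rewrite {1}sE -gf; apply: mkseq_prefix; apply: leq_maxl.
apply: (eN n); exists (mkseq (full f) n); split=> //.
by apply/extendibleP; exists f; rewrite size_mkseq.
Qed.

End Paths.

Variables (P : Type) (par : P -> autQ).
Hypothesis parJ : forall p, J0 (full (par p)).

(** Evaluates a term at index [i] from finite restrictions alone. An inverse is a search, with the
    two indices exchanged, and a variable beyond the environment is the identity, as in
    [term_val]. *)
Fixpoint term_rel (s : prefixes) (t : term P) (i v : nat) : Prop :=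
  match t with
  | Var j => (i < size (nth [::] s j) /\ nth 0 (nth [::] s j) i = v) \/
             (size s <= j /\ i = v)
  | Par p => full (par p) i = v
  | One => i = v
  | Mul t u => exists m, term_rel s u i m /\ term_rel s t m v
  | Defs.Inv t => term_rel s t v i
  end.

Lemma re_term_rel t A (eA : encoding A) (s : A -> prefixes) i v :
  eff J0 s -> eff J0 i -> eff J0 v -> re J0 (fun a => term_rel (s a) t (i a) (v a)).
Proof.
elim: t A eA s i v => [j|p||t IHt u IHu|t IHt] A eA s i v sP iP vP /=; re_tac.
- by apply: (eff_size J0P [::]).
- by apply: (eff_comp J0P ((ideal_eff _ _).1 (parJ p))).
- by apply: IHu; eff_tac; [apply: (eff_comp J0P sP) | apply: (eff_comp J0P iP)]; eff_tac.
- by apply: IHt; eff_tac; [apply: (eff_comp J0P sP) | apply: (eff_comp J0P vP)]; eff_tac.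
- exact: IHt.
Qed.

Lemma term_rel_le t s s' i v : env_le s s' -> term_rel s t i v -> term_rel s' t i v.
Proof.
move=> ss'; elim: t i v => //= [j|t IHt u IHu|t IHt] i v.
- case=> [[li <-]|[lj <-]]; last by right; rewrite -ss'.1.
  by left; have [] := nth_prefix (ss'.2 j) li.
- by case=> m [/IHu um /IHt tm]; exists m.
- exact: IHt.
Qed.

Lemma full_one i : full 1%g i = i.
Proof. by apply: (@elt_inj Q); rewrite elt_full. Qed.

Lemma full_mul f g i : full (f * g)%g i = full f (full g i).
Proof. by apply: (@elt_inj Q); rewrite !elt_full. Qed.

Lemma term_rel_full t n e i v : term_rel (pre n e) t i v -> full (term_val par e t) i = v.
Proof.
elim: t i v => //= [j||t IHt u IHu|t IHt] i v.
- rewrite nth_pre size_map; case: (ltnP j (size e)) => [ltj|lej]; last first.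
    by case=> [[]//|[_ <-]]; rewrite nth_default // full_one.
  by case=> [[]|[]//]; rewrite size_mkseq => lin; rewrite nth_mkseq.
- by rewrite full_one.
- by case=> m [/IHu um /IHt <-]; rewrite full_mul um.
- by move=> /IHt <-; rewrite -full_mul mulVg full_one.
Qed.

Lemma term_rel_ex t e i : exists n, term_rel (pre n e) t i (full (term_val par e t) i).
Proof.
elim: t i => [j|p||t IHt u IHu|t IHt] i /=.
- exists i.+1; rewrite nth_pre size_map; case: (ltnP j (size e)) => [ltj|lej].
    by left; rewrite size_mkseq nth_mkseq //.
  by right; rewrite nth_default // full_one.
- by exists 0.
- by exists 0; rewrite full_one.
- have [m um] := IHu i; have [n tn] := IHt (full (term_val par e u) i).
  exists (maxn m n), (full (term_val par e u) i); split.
    by apply: term_rel_le um; apply: pre_le; apply: leq_maxl.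
  by rewrite full_mul; apply: term_rel_le tn; apply: pre_le; apply: leq_maxr.
- have [n tn] := IHt (full (term_val par e t)^-1%g i).
  by exists n; rewrite -full_mul mulgV full_one in tn.
Qed.

(* For a positive formula, [refute phi s] says that no environment with      *)
(* restrictions [s] satisfies [phi].                                         *)
Fixpoint refute (phi : formula P) : prefixes -> Prop :=
  match phi with
  | Eq t u => fun s => exists i v w, term_rel s t i v /\ (term_rel s u i w /\ v <> w)
  | Neg _ => fun=> False
  | And phi psi => fun s => refute phi s \/ refute psi s
  | Or phi psi => fun s => refute phi s /\ refute psi s
  | Ex phi => ex_refute (refute phi)
  | All phi => all_refute (refute phi)
  end.

Lemma re_refute phi : re J0 (refute phi).
Proof.
elim: phi => /= [t u|phi _|phi IHphi psi IHpsi|phi IHphi psi IHpsi|phi IHphi|phi IHphi].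
- by re_tac; apply: re_term_rel; eff_tac.
- apply: (@re_iff _ _ _ (fun=> false)) => //; apply: re_dec => //; eff_tac.
- exact: re_or.
- exact: re_and.
- exact: re_ex_refute.
- exact: re_all_refute.
Qed.

Lemma monotone_refute phi : monotone (refute phi).
Proof.
elim: phi => /= [t u|phi _|phi IHphi psi IHpsi|phi IHphi psi IHpsi|phi IHphi|phi IHphi].
- move=> s s' ss' [i [v [w [tv [uw vw]]]]]; exists i, v, w.
  by split; [apply: term_rel_le tv | split=> //; apply: term_rel_le uw].
- by [].
- by move=> s t st [/(IHphi _ _ st)|/(IHpsi _ _ st)]; [left | right].
- by move=> s t st [/(IHphi _ _ st) ? /(IHpsi _ _ st)].
- exact: monotone_ex_refute.
- exact: monotone_all_refute.
Qed.

(** As [refute] does not mention [J], this makes positive formulas absolute. Monotonicity brings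
    refutations found at different stages, of two disjuncts or of two sides of an equation, to a
    common stage. *)
Lemma refute_correct J phi e : path_ideal J -> J0 `<=` J -> neg_free phi ->
  (forall f, f \in e -> AutJ J f) ->
  sat (AutJ J) par e phi <-> forall n, ~ refute phi (pre n e).
Proof.
move=> JP sJ.
elim: phi e => //= [t u|phi IHphi psi IHpsi|phi IHphi psi IHpsi|phi IHphi|phi IHphi] e.
- move=> _ eJ; split=> [tu n [i [v [w [/term_rel_full <- [/term_rel_full <-]]]]]|eN].
    by rewrite tu.
  apply: autQ_ext => x; apply: (can_inj (idxK Q)); apply: contrapT => ne.
  have [m tm] := term_rel_ex t e (idx Q x); have [n un] := term_rel_ex u e (idx Q x).
  apply: (eN (maxn m n)); do 3!eexists; split; last split.
  + by apply: term_rel_le tm; apply: pre_le; apply: leq_maxl.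
  + by apply: term_rel_le un; apply: pre_le; apply: leq_maxr.
  + by rewrite /index_map idxK.
- move=> /andP[nphi npsi] eJ; rewrite IHphi // IHpsi //.
  by split=> [[phiN psiN] n [/phiN|/psiN]|N]; [..|split=> n Un; apply: (N n); [left|right]].
- move=> /andP[nphi npsi] eJ; rewrite IHphi // IHpsi //.
  split=> [[phiN n [/phiN]|psiN n [_ /psiN]] //|N].
  have [|/existsNP[m /contrapT phim]] := pselect (forall n, ~ refute phi (pre n e)); first by left.
  right=> n psin; apply: (N (maxn m n)); split.
    by apply: monotone_refute phim; apply: pre_le; apply: leq_maxl.
  by apply: monotone_refute psin; apply: pre_le; apply: leq_maxr.
- move=> nphi eJ; rewrite -(ex_refute_correct JP sJ (re_refute phi) (@monotone_refute phi) eJ).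
  by split=> -[f Jf]; [rewrite IHphi // => [fN|g] | move=> fN];
    [exists f | rewrite inE => /orP[/eqP->|/eJ] // | exists f => //; apply/IHphi => // g;
    rewrite inE => /orP[/eqP->|/eJ]].
- move=> nphi eJ; rewrite -(all_refute_correct JP sJ e (@monotone_refute phi)).
  have feJ f : AutJ J f -> forall g, g \in f :: e -> AutJ J g.
    by move=> Jf g; rewrite inE => /orP[/eqP->|/eJ].
  by split=> sphi f Jf; apply/IHphi => //; [apply: feJ | apply: sphi | apply: feJ | apply: sphi].
Qed.

End Enumeration.

End Logic.

(** * Separated formulas *)

Section Blocks.
Variables (G : groupType) (D : set G) (P : Type) (par : P -> G).
Implicit Types (phi : formula P) (e h : seq G).

(** The head of an environment belongs to the innermost binder, so the witness of the outermost one
    ends the block; hence the use of [rcons]. *)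
Lemma sat_iter_ex k phi e : sat D par e (iter k (@Ex P) phi) <->
  exists h, [/\ size h = k, forall x, x \in h -> D x & sat D par (h ++ e) phi].
Proof.
elim: k e => [|k IHk] e; first by split=> [ephi|[h [/size0nil-> _]//]]; exists [::].
rewrite iterS /=; split=> [[x Dx /IHk[h [hk hD hphi]]]|[h [hk hD hphi]]].
  exists (rcons h x); split; rewrite ?size_rcons ?hk ?cat_rcons // => y.
  by rewrite mem_rcons inE => /orP[/eqP->|/hD].
case/lastP: h => [|h x] // in hk hD hphi *; exists x; first by apply: hD; rewrite mem_rcons mem_head.
apply/IHk; exists h; rewrite -cat_rcons; split=> // [|y hy].
  by apply: succn_inj; rewrite -hk size_rcons.
by apply: hD; rewrite mem_rcons inE hy orbT.
Qed.

Lemma sat_iter_all k phi e : sat D par e (iter k (@All P) phi) <->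
  forall h, size h = k -> (forall x, x \in h -> D x) -> sat D par (h ++ e) phi.
Proof.
elim: k e => [|k IHk] e; first by split=> [ephi h /size0nil->|/(_ [::])] //; apply.
rewrite iterS /=; split=> [sphi h hk hD|sphi x Dx].
  case/lastP: h => [|h x] // in hk hD *; rewrite cat_rcons.
  have Dx : D x by apply: hD; rewrite mem_rcons mem_head.
  apply: ((IHk _).1 (sphi x Dx)) => [|y hy].
    by apply: succn_inj; rewrite -hk size_rcons.
  by apply: hD; rewrite mem_rcons inE hy orbT.
apply/IHk => h hk hD; rewrite -cat_rcons; apply: sphi => [|y]; first by rewrite size_rcons hk.
by rewrite mem_rcons inE => /orP[/eqP->|/hD].
Qed.

(** For a quantifier-free negative formula this is its negation in positive form. *)
Fixpoint dual phi : formula P :=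
  match phi with
  | Neg phi => phi
  | And phi psi => Or (dual phi) (dual psi)
  | Or phi psi => And (dual phi) (dual psi)
  | _ => phi
  end.

Lemma neg_free_dual phi : qf_negative phi -> neg_free (dual phi).
Proof.
elim: phi => //= [[]//|phi IHphi psi IHpsi|phi IHphi psi IHpsi];
  by move=> /andP[/IHphi-> /IHpsi->].
Qed.

Lemma sat_dual phi e : qf_negative phi -> sat D par e phi <-> ~ sat D par e (dual phi).
Proof.
elim: phi => //= [phi IHphi psi IHpsi|phi IHphi psi IHpsi].
  move=> /andP[/IHphi-> /IHpsi->]; split=> [[nphi npsi] [/nphi|/npsi]|N] //.
  by split=> H; apply: N; [left | right].
move=> /andP[/IHphi-> /IHpsi->]; split=> [[N|N] [] //|N].
by have [sphi|] := pselect (sat D par e (dual phi)); [right=> spsi; apply: N | left].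
Qed.

End Blocks.

Lemma neg_free_iter_ex P k (phi : formula P) : neg_free (iter k (@Ex P) phi) = neg_free phi.
Proof. by elim: k. Qed.

Lemma neg_free_iter_all P k (phi : formula P) : neg_free (iter k (@All P) phi) = neg_free phi.
Proof. by elim: k. Qed.

Section Transfer.
Variables (Q : presentation) (F : tower Q).
Local Notation full := (index_map Q).
Variables (J0 : set (nat -> nat)) (J0P : turing_ideal J0) (P : Type) (par : P -> autQ).
Hypothesis parJ : forall p, J0 (full (par p)).

Definition incompatible (s t : seq (seq nat)) : Prop := exists j i,
  i < size (nth [::] s j) /\ (i < size (nth [::] t j) /\
    nth 0 (nth [::] s j) i <> nth 0 (nth [::] t j) i).

Lemma re_incompatible s : re J0 (incompatible s).
Proof. by rewrite /incompatible; re_tac. Qed.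

Lemma monotone_incompatible s : monotone (incompatible s).
Proof.
move=> t u tu [j [i [lis [lit sit]]]]; exists j, i.
by have [liu ->] := nth_prefix (tu.2 j) lit.
Qed.

Lemma compatible_pre s n e : (exists m, s = pre Q m e) -> ~ incompatible s (pre Q n e).
Proof.
move=> [m ->] [j [i []]]; rewrite !nth_pre; case: ifP => // _.
by rewrite !size_mkseq => lim [lin]; rewrite !nth_mkseq.
Qed.

(** Turns the closed condition of never disagreeing with [s] into extending [s]; the longest string
    in [s] gives the stage. *)
Lemma compatible_le s e : size s = size e -> (forall n, ~ incompatible s (pre Q n e)) ->
  exists n, env_le s (pre Q n e).
Proof.
move=> se compat; pose n := \max_(u <- s) size u; exists n; split; first by rewrite size_map.
move=> j; rewrite nth_pre; case: ltnP => [ltj|lej]; last by rewrite nth_default ?se.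
have lejn : size (nth [::] s j) <= n by rewrite /n leq_bigmax_seq // mem_nth ?se.
suff -> : nth [::] s j = mkseq (full (nth autQ_one e j)) (size (nth [::] s j)).
  exact: mkseq_prefix.
apply: (@eq_from_nth _ 0); rewrite ?size_mkseq // => i lti.
apply: contrapT => ne; apply: (compat n); exists j, i; rewrite nth_pre ltj size_mkseq.
have ltin := leq_trans lti lejn; split=> //; split=> //.
by rewrite nth_mkseq // in ne *; rewrite nth_mkseq.
Qed.

Lemma sat_positive J J' phi : path_ideal J -> path_ideal J' -> J0 `<=` J -> J0 `<=` J' ->
  neg_free phi -> sat (AutJ Q J) par [::] phi <-> sat (AutJ Q J') par [::] phi.
Proof.
move=> JP JP' sJ sJ' nphi; have [B JB fullB] := full_bound Q J0P.
by rewrite (refute_correct F J0P JB fullB parJ JP sJ) // (refute_correct F J0P JB fullB parJ JP' sJ').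
Qed.

(** Here [U] need not come from a formula, so agreement with given finite data can be imposed on the
    witnesses. *)
Lemma ex_refute_iter_correct B (JB : J0 B) (fullB : forall f i, full f i <= B i) J
    (JP : path_ideal J) (sJ : J0 `<=` J) k U e : re J0 U -> monotone U ->
  (forall f, f \in e -> AutJ Q J f) ->
  (exists h, [/\ size h = k, forall f, f \in h -> AutJ Q J f &
     forall n, ~ U (pre Q n (h ++ e))]) <->
  forall n, ~ iter k (ex_refute Q B) U (pre Q n e).
Proof.
move=> UP Umono; elim: k e => [|k IHk] e eJ.
  by split=> [[h [/size0nil-> _]]//|eN]; exists [::].
have [kP kmono] : re J0 (iter k (ex_refute Q B) U) /\ monotone (iter k (ex_refute Q B) U).
  elim: (k) => //= m [mP mmono]; split; first exact: re_ex_refute.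
  exact: monotone_ex_refute.
rewrite iterS -(ex_refute_correct JB fullB JP sJ kP kmono eJ).
have feJ f : AutJ Q J f -> forall g, g \in f :: e -> AutJ Q J g.
  by move=> Jf g; rewrite inE => /orP[/eqP->|/eJ].
split=> [[h [hk hJ hU]]|[f Jf /(IHk _ (feJ f Jf))[h [hk hJ hU]]]].
  case/lastP: h => [|h f] // in hk hJ hU *.
  have Jf : AutJ Q J f by apply: hJ; rewrite mem_rcons mem_head.
  exists f => //; apply/(IHk _ (feJ f Jf)); exists h; split.
  - by apply: succn_inj; rewrite -hk size_rcons.
  - by move=> g hg; apply: hJ; rewrite mem_rcons inE hg orbT.
  - by move=> n; rewrite -cat_rcons.
exists (rcons h f); split; first by rewrite size_rcons hk.
  by move=> g; rewrite mem_rcons inE => /orP[/eqP->|/hJ].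
by move=> n; rewrite cat_rcons.
Qed.

(* A universal block over a positive and a negative formula defines the      *)
(* intersection of a closed and an open set; the open one is witnessed by    *)
(* finite data, which a path through the tree of the closed one can extend.  *)
Lemma sat_separated B (JB : J0 B) (fullB : forall f i, full f i <= B i) J k l alpha beta :
  path_ideal J -> J0 `<=` J -> neg_free alpha -> qf_negative beta ->
  sat (AutJ Q J) par [::] (iter k (@Ex P) (iter l (@All P) (And alpha beta))) <->
  exists s, [/\ size s = k, refute F B par (iter l (@Ex P) (dual beta)) s &
    forall n : nat, ~ iter k (ex_refute Q B)
      (fun t => refute F B par (iter l (@All P) alpha) t \/ incompatible s t) [::]].
Proof.
move=> JP sJ nalpha nbeta.
have correct phi e := refute_correct (e := e) (phi := phi) F J0P JB fullB parJ JP sJ.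
(* The universal block distributes over the conjunction: the positive half is closed, and the
   negative half says that a positive existential formula fails, which some finite stage reveals. *)
have split_all e : (forall f, f \in e -> AutJ Q J f) ->
  sat (AutJ Q J) par e (iter l (@All P) (And alpha beta)) <->
  (forall n, ~ refute F B par (iter l (@All P) alpha) (pre Q n e)) /\
  exists n, refute F B par (iter l (@Ex P) (dual beta)) (pre Q n e).
  move=> eJ; rewrite -correct ?neg_free_iter_all // sat_iter_all.
  transitivity (sat (AutJ Q J) par e (iter l (@All P) alpha) /\
      ~ sat (AutJ Q J) par e (iter l (@Ex P) (dual beta))).
    rewrite sat_iter_all sat_iter_ex; split=> [H|[Ha Hb] h hl hJ].
      split=> [h hl hJ|[h [hl hJ]]]; first by have [] := H h hl hJ.
      by have [_ /(sat_dual _ _ _ nbeta)] := H h hl hJ.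
    by split; [apply: Ha | apply/(sat_dual _ _ _ nbeta) => sb; apply: Hb; exists h].
  rewrite !correct ?neg_free_iter_ex ?neg_free_iter_all ?neg_free_dual //.
  split=> -[sa]; first by move=> /existsNP[n /contrapT rn]; split=> //; exists n.
  by move=> [n rn]; split=> // /(_ n).
pose U s t := refute F B par (iter l (@All P) alpha) t \/ incompatible s t.
have UP s : re J0 (U s).
  by apply: re_or => //; [apply: re_refute | apply: re_incompatible].
have Umono s : monotone (U s).
  by move=> t u tu [/(monotone_refute tu)|/(monotone_incompatible tu)]; [left | right].
have correct_iter s := ex_refute_iter_correct JB fullB JP sJ k (UP s) (Umono s) (e := [::]).
rewrite sat_iter_ex; split=> [[e [ek eJ]]|[s [sk rs /(correct_iter s)]]].
  rewrite cats0 => /(split_all e eJ)[ea [n en]].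
  exists (pre Q n e); split; rewrite ?size_map //.
  apply: (correct_iter (pre Q n e) _).1 => //; exists e; split=> // m.
  rewrite cats0 => -[/ea //|]; apply: compatible_pre; by exists n.
case=> // e [ek eJ eN]; exists e; split=> //; rewrite cats0 in eN *.
apply/split_all => //; split; first by move=> n en; apply: (eN n); left.
have [|n sn] := @compatible_le s e _ (fun n en => eN n (or_intror en)); first by rewrite sk.
by exists n; apply: monotone_refute sn rs.
Qed.

(** Both sides are equivalent to one condition free of the ideal, from [refute_correct] if the
    matrix is positive and from [sat_separated] otherwise. *)
Lemma sat_sigma2 J psi : path_ideal J -> J0 `<=` J -> sigma_separated 2 psi ->
  sat (AutJ Q J) par [::] psi <-> sat (AutJ Q setT) par [::] psi.
Proof.
move=> JP sJ [k [_ [-> [l [gamma [-> gammaP]]]]]].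
have subT : J0 `<=` setT by [].
case: gammaP => [/andP[_ ngamma]|[alpha [beta [-> /andP[_ nalpha] nbeta]]]].
  apply: (sat_positive JP path_ideal_setT) => //.
  by rewrite neg_free_iter_ex neg_free_iter_all.
have [B JB fullB] := full_bound Q J0P.
rewrite (sat_separated JB fullB k l JP sJ nalpha nbeta).
by rewrite (sat_separated JB fullB k l path_ideal_setT subT nalpha nbeta).
Qed.

End Transfer.

Theorem theorem4p6 (Q : presentation) (F : tower Q) (I : set tdegree)
    (hI : scott_ideal I)
    (psi : formula {f : autQ | AutI F I f})
    (hpsi : sentence psi) (hsep : sigma_separated 2 psi)
    (phi : formula {f : autQ | AutI F I f}) (hphi : phi = psi \/ phi = Neg psi) :
  sat (AutI F I) (@proj1_sig _ _) [::] phi <-> sat setT (@proj1_sig _ _) [::] phi.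
Proof.
pose J0 := [set f | I (deg f)].
have JP : path_ideal J0 := path_ideal_scott hI.
have fullP f : AutI F I f <-> J0 (index_map Q f) := full_ideal F f JP.
have autI : AutI F I = AutJ Q J0 by apply/seteqP; split=> f /fullP.
have parJ (p : {f | AutI F I f}) : J0 (index_map Q (proj1_sig p)) by apply/fullP; case: p.
(* The functions of the Scott ideal serve both as the ideal of the parameters and as the one
   compared with all functions. *)
have psiE := sat_sigma2 F JP parJ JP (fun _ => id) hsep.
by rewrite -autI in psiE; case: hphi => -> //=; rewrite psiE.
Qed.
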